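(* Let $k$ be an algebraically closed field, $n\ge2$, $G=\mathrm{GL}_n(k)$, $\mathfrak g=\mathfrak{gl}_n(k)$, and $k[\mathfrak g]=k[\xi_{ij}:1\le i,j\le n]$. Assume $t=1$, or $n\ge3$ and $t\in\{1,n-2,n-1\}$. Put $\lambda^t=(t,0,\dots,0,-1,\dots,-1)$ (with $t$ entries $-1$) and $\mu^t=(1,\dots,1,0,\dots,0,-t)$ (with $t$ entries $1$), and for $I\subseteq\{2,\dots,n\}$ with $|I|=t$ define $$u_{t,I}=\det\big((\partial_{1i}s_j)_{n-t+1\le i\le n,\ j\in I}\big),\qquad v_{t,I}=\det\big((\partial_{in}s_j)_{1\le i\le t,\ j\in I}\big),$$ with the indices in $I$ in increasing order. Then the $u_{t,I}$, $I\subseteq\{2,\dots,n\}$ with $|I|=t$, are algebraically independent over $k[\mathfrak g]^G$ and generate the $k[\mathfrak g]^G$-algebra $\bigoplus_{r\ge0}k[\mathfrak g]^U_{r\lambda^t}$. The same holds for the $v_{t,I}$ and $\bigoplus_{r\ge0}k[\mathfrak g]^U_{r\mu^t}$.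
   Context: $G$ acts on $\mathfrak g$ by conjugation and on $k[\mathfrak g]$ by $(g\cdot f)(x)=f(g^{-1}xg)$. $U$ is the subgroup of upper unitriangular matrices and $T$ the diagonal torus; $(\lambda_1,\dots,\lambda_n)\in\mathbb Z^n$ denotes the character $\mathrm{diag}(a_1,\dots,a_n)\mapsto\prod a_i^{\lambda_i}$ of $T$. $k[\mathfrak g]^U_\lambda$ is the space of $U$-invariant polynomials of $T$-weight $\lambda$. $s_i(x)=\mathrm{tr}(\wedge^i x)$ for $1\le i\le n$, and $\partial_{ij}=\partial/\partial\xi_{ij}$. *)

(* Defs.v *)
From HB Require Import structures.
From mathcomp Require Import all_boot all_order all_algebra.
From mathcomp Require Import mpoly.
Set Implicit Arguments. Unset Strict Implicit. Unset Printing Implicit Defensive.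
Import Order.TTheory GRing.Theory Num.Theory.
Local Open Scope ring_scope.

(* k[g] = k[xi_ij : 1 <= i,j <= n]: polynomials in n*n variables; the
   variable xi_ij is 'X_(mxvec_index i j) (indices are 0-based). *)
Notation kg F n := {mpoly F[n * n]}.

Section Defs.
Variable F : fieldType.

Definition xi n (i j : 'I_n) : kg F n := 'X_(mxvec_index i j).
Definition dxi n (i j : 'I_n) (p : kg F n) : kg F n := mderiv (mxvec_index i j) p.

Definition genmx n : 'M[kg F n]_n := \matrix_(i, j) xi i j.

(* s_j(x) = tr(wedge^j x) = sum of the principal j x j minors of x *)
Definition s_inv n (j : nat) : kg F n :=
  \sum_(A : {set 'I_n} | #|A| == j)
     \det (\matrix_(a < #|A|, b < #|A|)
             genmx n (enum_val (A := mem A) a) (enum_val (A := mem A) b)).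

Definition act n (g : 'M[F]_n) (f : kg F n) : kg F n :=
  let M := map_mx (@mpolyC _ F) (invmx g) *m genmx n *m map_mx (@mpolyC _ F) g in
  f \mPo [tuple (mxvec M) 0 i | i < n * n].

Definition GLn n (g : 'M[F]_n) : bool := g \in unitmx.

Definition unitri n (g : 'M[F]_n) : Prop :=
  forall i j : 'I_n, ((j < i)%N -> g i j = 0) /\ (i = j -> g i j = 1).

Definition torus n (a : 'I_n -> F) : Prop := forall i, a i != 0.
Definition diagm n (a : 'I_n -> F) : 'M[F]_n := \matrix_(i, j) (a i *+ (i == j)).

Definition character n (lam : 'I_n -> int) (a : 'I_n -> F) : F :=
  \prod_(i < n) a i ^ lam i.

Definition G_invariant n (f : kg F n) : Prop :=
  forall g : 'M[F]_n, GLn g -> act g f = f.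

Definition U_inv_weight n (lam : 'I_n -> int) (f : kg F n) : Prop :=
  (forall u : 'M[F]_n, unitri u -> act u f = f) /\
  (forall a : 'I_n -> F, torus a -> act (diagm a) f = character lam a *: f).

(* From here on the dimension is n.+1 (so that index 1 = ord0 exists).  *)
Definition lambda_t n (t : nat) : 'I_n.+1 -> int :=
  fun i => if i == ord0 then (t%:Z) else if (n.+1 - t <= i)%N then -1 else 0.
Definition mu_t n (t : nat) : 'I_n.+1 -> int :=
  fun i => if i == ord_max then - (t%:Z) else if (i < t)%N then 1 else 0.

(* I subset {2,...,n}, |I| = t; I is a set of numbers in {0..n} *)
Definition admissible n (t : nat) (I : {set 'I_n.+2}) : bool :=
  [forall j in I, (2 <= j)%N] && (#|I| == t).

Definition Ielt n (I : {set 'I_n.+2}) (b : nat) : nat := nth 0%N (map val (enum I)) b.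

Definition u_tI n (t : nat) (I : {set 'I_n.+2}) : kg F n.+1 :=
  \det (\matrix_(a < t, b < t)
          dxi ord0 (inord (n.+1 - t + a)) (s_inv n.+1 (Ielt I b))).
Definition v_tI n (t : nat) (I : {set 'I_n.+2}) : kg F n.+1 :=
  \det (\matrix_(a < t, b < t)
          dxi (inord a) ord_max (s_inv n.+1 (Ielt I b))).

End Defs.

Section Gen.
Variable F : fieldType.

(* The family w : 'I_m -> k[g] (all in k[g]^U_lam) is algebraically
   independent over k[g]^G and generates the k[g]^G-algebra
   (+)_{r >= 0} k[g]^U_{r lam}.  Polynomials in the w's with coefficients
   in k[g]^G are elements P of k[g][Y_1..Y_m] all of whose coefficients
   are G-invariant, evaluated at Y = w. *)
Definition free_generators n (lam : 'I_n -> int) (m : nat) (w : 'I_m -> kg F n) : Prop :=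
  (forall i, U_inv_weight lam (w i)) /\
  (forall P : {mpoly (kg F n)[m]},
      (forall mo, G_invariant (P@_mo)) -> P.@[w] = 0 -> P = 0) /\
  (forall (R : nat) (f : 'I_R -> kg F n),
      (forall r : 'I_R, U_inv_weight (fun i => (r%:Z * lam i)%R) (f r)) ->
      exists P : {mpoly (kg F n)[m]},
        (forall mo, G_invariant (P@_mo)) /\ \sum_(r < R) f r = P.@[w]).
End Gen.

(* Main.v *)
Require Import Defs.
From HB Require Import structures.
From mathcomp Require Import all_boot all_order all_algebra.
From mathcomp Require Import fingroup perm mpoly.
From mathcomp Require Import ring zify.
Import Order.TTheory GRing.Theory Num.Theory.
Local Open Scope ring_scope.
Set Implicit Arguments. Unset Strict Implicit. Unset Printing Implicit Defensive.

(* Let K(x) be the matrix whose j-th column is the coefficient of z^(j-1) in the first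
   column of adj(1 + z x).  Its (i,j) entry is the partial derivative of s_j with respect
   to xi_(1i), its first column is e_1, and x K(x) = K(x) C(s(x)) for a companion matrix C,
   so u_(t,I) is the minor of K(x) on the last t rows and the columns in I, and a function f
   satisfies f(x) = f(K C(s) K^-1) wherever K = K(x) is invertible.  Conjugating x by g with
   g e_1 = e_1 turns K into g K.  If f is U-invariant of weight r lambda^t, the function
   K |-> f(K C(c) K^-1) on GL_n is semi-invariant under the upper triangular matrices; a
   P^1 argument extends this to the whole block parabolic subgroup, with character the
   r-th power of the determinant of the last t x t block D.  Hence f is det(D)^r times a
   polynomial in s and in the coordinates of the Grassmannian of the last t rows in the
   chart det D != 0.  For t in {1, n-2, n-1} that Grassmannian (of t-planes in (n-1)-space)
   is a projective space, and regularity of f at the hyperplane at infinity bounds the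
   degree in the chart coordinates by r, which makes f a polynomial in s and the u_(t,I).
   Independence holds since conjugation moves the last t rows of K(x) arbitrarily without
   changing the invariants.  The v_(t,I) are the u_(t,I) composed with the transposition
   along the antidiagonal, up to a sign. *)

(** * Polynomial functions *)

Section Univariate.
Variable F : closedFieldType.
Implicit Types p q : {poly F}.

Lemma poly_eq_nz p q : (forall s, s != 0 -> p.[s] = q.[s]) -> p = q.
Proof.
move=> e; apply/eqP; rewrite -subr_eq0; apply/negPn/negP => nz.
(* The factor ['X] forces the non-root found below to be nonzero. *)
have nz' : (p - q) * 'X != 0 by rewrite mulf_neq0 // polyX_eq0.
case/closed_nonrootP: nz' => s; rewrite /root hornerM hornerX mulf_eq0 negb_or.
by case/andP=> h /e h'; rewrite !hornerE h' subrr eqxx in h.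
Qed.

Lemma poly_eq_ext p q : (forall s, p.[s] = q.[s]) -> p = q.
Proof. by move=> e; apply: poly_eq_nz => s _. Qed.

Lemma horner_mulXn_inv q d s : s != 0 -> (size q <= d)%N ->
  s ^+ d * q.[s^-1] = (\poly_(i < d.+1) q`_(d - i)).[s].
Proof.
move=> s0 hq; rewrite horner_poly (reindex_inj rev_ord_inj) /=.
rewrite (@horner_coef_wide _ d.+1) ?(leq_trans hq) // mulr_sumr.
apply: eq_bigr => i _; have hi : (i <= d)%N by rewrite -ltnS.
rewrite subSS subKn // mulrCA; congr (_ * _).
by rewrite exprVn -expfB_cond // (negPf s0).
Qed.

(** Multiplying by a power of [s] turns the hypothesis into an identity of polynomials; a term of
    [q] of degree above [r] would be a pole at [s = 0]. *)
Lemma laurent_size_le q p r :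
  (forall s, s != 0 -> s ^+ r * q.[s^-1] = p.[s]) -> (size q <= r.+1)%N.
Proof.
move=> e; apply/leq_sizeP => d hd.
have [hs|hs] := leqP (size q) d; first by rewrite nth_default.
pose D := size q.
have E : 'X^r * \poly_(i < D.+1) q`_(D - i) = 'X^D * p.
  apply: poly_eq_nz => s s0; rewrite !hornerM !hornerXn -horner_mulXn_inv //.
  by rewrite mulrCA e.
(* As [d > r], this index is below [D]: the right side contributes 0 and the left side the
   coefficient of [q] in degree [d]. *)
have := congr1 (fun u : {poly F} => u`_(r + (D - d))) E.
rewrite /= !coefXnM coef_poly; case: ifP; first by rewrite ltnNge leq_addr.
rewrite addKn ltnS leq_subr subKn ?(ltnW hs) // => _ ->.
by case: ifP => //; rewrite ltnNge => /negbFE; rewrite -/D; move: hd hs; rewrite -/D; lia.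
Qed.

(** A regular function on the projective line is constant; [p.[0]] and [q.[0]] are its values at 0
    and at infinity. *)
Lemma laurent_const p q : (forall s, s != 0 -> p.[s] = q.[s^-1]) -> p.[0] = q.[0].
Proof.
move=> e.
have hq : (size q <= 1)%N.
  by apply: (@laurent_size_le q p 0) => s s0; rewrite expr0 mul1r e.
have hp : p = q.
  apply: poly_eq_nz => s s0; rewrite e //.
  by rewrite (size1_polyC hq) !hornerC.
by rewrite hp.
Qed.

End Univariate.

(** * Finitely generated expressions: algebras of functions *)

Section Alg.
Variable F : closedFieldType.

(** The [F]-algebra of functions on [T] generated by the [X j]. The last constructor replaces
    functional extensionality. *)
Inductive gen_alg (T J : Type) (X : J -> T -> F) : (T -> F) -> Prop :=
| gen_alg_gen j : gen_alg X (X j)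
| gen_alg_const c : gen_alg X (fun=> c)
| gen_alg_add f g : gen_alg X f -> gen_alg X g -> gen_alg X (fun t => f t + g t)
| gen_alg_mul f g : gen_alg X f -> gen_alg X g -> gen_alg X (fun t => f t * g t)
| gen_alg_ext f g : gen_alg X f -> f =1 g -> gen_alg X g.

Section Closure.
Variables (T J : Type) (X : J -> T -> F).

Lemma gen_alg_sum I (s : seq I) (P : pred I) (f : I -> T -> F) :
  (forall i, P i -> gen_alg X (f i)) -> gen_alg X (fun t => \sum_(i <- s | P i) f i t).
Proof.
move=> h; elim: s => [|i s IH].
  by apply: (gen_alg_ext (gen_alg_const X 0)) => t; rewrite big_nil.
case Pi: (P i).
  by apply: (gen_alg_ext (gen_alg_add (h i Pi) IH)) => t; rewrite big_cons Pi.
by apply: (gen_alg_ext IH) => t; rewrite big_cons Pi.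
Qed.

Lemma gen_alg_prod I (s : seq I) (P : pred I) (f : I -> T -> F) :
  (forall i, P i -> gen_alg X (f i)) -> gen_alg X (fun t => \prod_(i <- s | P i) f i t).
Proof.
move=> h; elim: s => [|i s IH].
  by apply: (gen_alg_ext (gen_alg_const X 1)) => t; rewrite big_nil.
case Pi: (P i).
  by apply: (gen_alg_ext (gen_alg_mul (h i Pi) IH)) => t; rewrite big_cons Pi.
by apply: (gen_alg_ext IH) => t; rewrite big_cons Pi.
Qed.

Lemma gen_alg_exp f k : gen_alg X f -> gen_alg X (fun t => f t ^+ k).
Proof.
move=> h; elim: k => [|k IH]; first exact: (gen_alg_ext (gen_alg_const X 1)).
by apply: (gen_alg_ext (gen_alg_mul h IH)) => t; rewrite exprS.
Qed.

Lemma gen_alg_scale c f : gen_alg X f -> gen_alg X (fun t => c * f t).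
Proof. by move=> h; apply: gen_alg_mul h; apply: gen_alg_const. Qed.

Lemma gen_alg_opp f : gen_alg X f -> gen_alg X (fun t => - f t).
Proof. by move=> h; apply: (gen_alg_ext (gen_alg_scale (-1) h)) => t; rewrite mulN1r. Qed.

Lemma gen_alg_sub f g : gen_alg X f -> gen_alg X g -> gen_alg X (fun t => f t - g t).
Proof. by move=> hf hg; apply: gen_alg_add hf (gen_alg_opp hg). Qed.

Definition gen_algmx a b (M : T -> 'M[F]_(a, b)) := forall i j, gen_alg X (fun t => M t i j).

Lemma gen_alg_det k (M : T -> 'M[F]_k) : gen_algmx M -> gen_alg X (fun t => \det (M t)).
Proof.
move=> h; apply: gen_alg_sum => s _; apply: gen_alg_scale; apply: gen_alg_prod => i _; exact: h.
Qed.

Lemma gen_algmx_mul a b c (M : T -> 'M[F]_(a, b)) (N : T -> 'M_(b, c)) :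
  gen_algmx M -> gen_algmx N -> gen_algmx (fun t => M t *m N t).
Proof.
move=> hM hN i j; have : gen_alg X (fun t => \sum_k M t i k * N t k j).
  by apply: gen_alg_sum => k _; apply: gen_alg_mul.
by move/gen_alg_ext; apply=> t; rewrite mxE.
Qed.

Lemma gen_algmx_adj k (M : T -> 'M[F]_k) : gen_algmx M -> gen_algmx (fun t => \adj (M t)).
Proof.
move=> h i j.
suff : gen_alg X (fun t => cofactor (M t) j i) by move/gen_alg_ext; apply=> t; rewrite mxE.
apply: gen_alg_scale; apply: gen_alg_det => a b.
by apply: (gen_alg_ext (h (lift j a) (lift i b))) => t; rewrite !mxE.
Qed.

Lemma gen_algmx_const a b (M : 'M[F]_(a, b)) : gen_algmx (fun=> M).
Proof. by move=> i j; apply: gen_alg_const. Qed.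

Lemma gen_algmx_add a b (M N : T -> 'M[F]_(a, b)) :
  gen_algmx M -> gen_algmx N -> gen_algmx (fun t => M t + N t).
Proof.
by move=> hM hN i j; apply: (gen_alg_ext (gen_alg_add (hM i j) (hN i j))) => t; rewrite mxE.
Qed.

Lemma gen_algmx_scale a b (f : T -> F) (M : T -> 'M[F]_(a, b)) :
  gen_alg X f -> gen_algmx M -> gen_algmx (fun t => f t *: M t).
Proof.
by move=> hf hM i j; apply: (gen_alg_ext (gen_alg_mul hf (hM i j))) => t; rewrite mxE.
Qed.

Lemma gen_algmx_block a b c d (M : T -> 'M[F]_(a, c)) (N : T -> 'M_(a, d))
    (P : T -> 'M_(b, c)) (Q : T -> 'M_(b, d)) :
  gen_algmx M -> gen_algmx N -> gen_algmx P -> gen_algmx Q ->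
  gen_algmx (fun t => block_mx (M t) (N t) (P t) (Q t)).
Proof.
move=> hM hN hP hQ i j.
case: (split_ordP i) => i' ->; case: (split_ordP j) => j' ->.
- by apply: (gen_alg_ext (hM i' j')) => t; rewrite block_mxEul.
- by apply: (gen_alg_ext (hN i' j')) => t; rewrite block_mxEur.
- by apply: (gen_alg_ext (hP i' j')) => t; rewrite block_mxEdl.
- by apply: (gen_alg_ext (hQ i' j')) => t; rewrite block_mxEdr.
Qed.

End Closure.

Lemma gen_alg_comp T J (X : J -> T -> F) T' J' (X' : J' -> T' -> F) (phi : T' -> T) f :
  (forall j, gen_alg X' (fun t => X j (phi t))) -> gen_alg X f -> gen_alg X' (fun t => f (phi t)).
Proof.
move=> h; elim=> [j|c|g k _ hg _ hk|g k _ hg _ hk|g k _ hg e].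
- exact: h.
- exact: gen_alg_const.
- exact: gen_alg_add.
- exact: gen_alg_mul.
- by apply: (gen_alg_ext hg) => t; rewrite e.
Qed.

Definition coord1 (_ : unit) (s : F) : F := s.

Lemma gen_alg_poly f : gen_alg coord1 f -> exists p : {poly F}, forall s, f s = p.[s].
Proof.
elim=> [j|c|g k _ [p hp] _ [q hq]|g k _ [p hp] _ [q hq]|g k _ [p hp] e].
- by exists 'X => s; rewrite hornerX.
- by exists c%:P => s; rewrite hornerC.
- by exists (p + q) => s; rewrite hornerD hp hq.
- by exists (p * q) => s; rewrite hornerM hp hq.
- by exists p => s; rewrite -e hp.
Qed.

Definition entry a b (ij : 'I_a * 'I_b) (M : 'M[F]_(a, b)) : F := M ij.1 ij.2.
Arguments entry : clear implicits.

Definition polyfun a b (f : 'M[F]_(a, b) -> F) := gen_alg (entry a b) f.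

Lemma gen_algmx_id a b : gen_algmx (entry a b) id.
Proof. by move=> i j; apply: (gen_alg_ext (gen_alg_gen _ (i, j))). Qed.

Lemma polyfun_comp a b (f : 'M[F]_(a, b) -> F) T J (X : J -> T -> F) (M : T -> 'M_(a, b)) :
  polyfun f -> gen_algmx X M -> gen_alg X (fun t => f (M t)).
Proof. by move=> hf hM; apply: gen_alg_comp hf => -[i j]; apply: hM. Qed.

Lemma polyfun_line a b (f : 'M[F]_(a, b) -> F) x y : polyfun f ->
  exists p : {poly F}, forall s, f (x + s *: (y - x)) = p.[s].
Proof.
move=> hf; apply: gen_alg_poly; apply: (polyfun_comp hf).
apply: gen_algmx_add; first exact: gen_algmx_const.
by apply: gen_algmx_scale; [apply: (gen_alg_gen _ tt)|apply: gen_algmx_const].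
Qed.

(** On the line from [x] to [x0] the function [d] is a nonzero polynomial, and its product with
    [f - g] vanishes; one-variable polynomials form a domain. *)
Lemma polyfun_density a b (d f g : 'M[F]_(a, b) -> F) x0 :
  polyfun d -> polyfun f -> polyfun g -> d x0 != 0 ->
  (forall x, d x != 0 -> f x = g x) -> f =1 g.
Proof.
move=> hd hf hg dx0 e x.
have [pd ed] := polyfun_line x x0 hd; have [p ep] := polyfun_line x x0 (gen_alg_sub hf hg).
have pd0 : pd != 0.
  apply/eqP => z; move: (ed 1); rewrite z horner0 scale1r addrC subrK => h.
  by rewrite h eqxx in dx0.
have : pd * p = 0.
  apply: poly_eq_ext => s; rewrite hornerM horner0 -ed -ep.
  have [->|nz] := eqVneq (d (x + s *: (x0 - x))) 0; first by rewrite mul0r.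
  by rewrite e // subrr mulr0.
move/eqP; rewrite mulf_eq0 (negPf pd0) /= => /eqP p0.
by apply/eqP; rewrite -subr_eq0; move: (ep 0); rewrite p0 horner0 scale0r addr0 => ->.
Qed.

(** Denominators are cleared by induction on [f], the exponents adding up. This serves for inverse
    matrices, with [d] the determinant. *)
Lemma gen_alg_scaled_inv a b (f : 'M[F]_(a, b) -> F) T J (X : J -> T -> F)
    (M : T -> 'M_(a, b)) (d : T -> F) :
  polyfun f -> gen_algmx X M -> gen_alg X d ->
  exists q N, gen_alg X N /\ forall t, d t != 0 -> f ((d t)^-1 *: M t) * d t ^+ q = N t.
Proof.
move=> hf hM hd; elim: hf => [[i j]|c|g k _ [p [N [hN eN]]] _ [q [O [hO eO]]]
   |g k _ [p [N [hN eN]]] _ [q [O [hO eO]]]|g k _ [p [N [hN eN]]] e].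
- exists 1%N, (fun t => M t i j); split; first exact: hM.
  by move=> t nz; rewrite /entry mxE /= expr1 mulrC mulrA mulfV // mul1r.
- exists 0%N, (fun=> c); split; first exact: gen_alg_const.
  by move=> t _; rewrite expr0 mulr1.
- exists (p + q)%N, (fun t => N t * d t ^+ q + O t * d t ^+ p); split.
    by apply: gen_alg_add; apply: gen_alg_mul => //; apply: gen_alg_exp.
  by move=> t nz; rewrite -eN // -eO // exprD; ring.
- exists (p + q)%N, (fun t => N t * O t); split; first exact: gen_alg_mul.
  by move=> t nz; rewrite -eN // -eO // exprD; ring.
- exists p, N; split=> // t nz; rewrite -eN // e //.
Qed.

(* The decomposition of a polynomial function into its homogeneous components
   with respect to the second group of variables, packed as the coefficients of
   a univariate polynomial. *)
Lemma gen_alg_homog T J1 J2 (X1 : J1 -> T -> F) (X2 : J2 -> T -> F) f :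
  gen_alg (fun j => match j with inl j1 => X1 j1 | inr j2 => X2 j2 end) f ->
  exists q : T -> {poly F},
  [/\ forall d, gen_alg (fun j => match j with inl j1 => X1 j1 | inr j2 => X2 j2 end)
                  (fun t => (q t)`_d),
      forall t, f t = (q t).[1] &
      forall t t' s, (forall j, X1 j t' = X1 j t) -> (forall j, X2 j t' = s * X2 j t) ->
        forall d, (q t')`_d = s ^+ d * (q t)`_d].
Proof.
set X := (fun j => _).
elim=> [[j|j]|c|g k _ [p [ap ep hp]] _ [q [aq eq hq]]
  |g k _ [p [ap ep hp]] _ [q [aq eq hq]]|g k _ [p [ap ep hp]] e].
- exists (fun t => (X1 j t)%:P); split=> [d|t|t t' s h1 h2 d].
  + case: d => [|d].
      by apply: (gen_alg_ext (gen_alg_gen X (inl j))) => t; rewrite coefC.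
    by apply: (gen_alg_ext (gen_alg_const X 0)) => t; rewrite coefC.
  + by rewrite hornerC.
  + by rewrite h1 !coefC; case: d => [|d] /=; rewrite ?mul1r ?mulr0.
- exists (fun t => X2 j t *: 'X); split=> [d|t|t t' s h1 h2 d].
  + have [->|nd] := eqVneq d 1%N.
      by apply: (gen_alg_ext (gen_alg_gen X (inr j))) => t; rewrite coefZ coefX mulr1.
    by apply: (gen_alg_ext (gen_alg_const X 0)) => t; rewrite coefZ coefX (negPf nd) mulr0.
  + by rewrite hornerZ hornerX mulr1.
  + rewrite h2 !coefZ !coefX; have [->|nd] := eqVneq d 1%N; last by rewrite !mulr0.
    by rewrite !mulr1.
- exists (fun=> c%:P); split=> [d|t|t t' s h1 h2 d].
  + by apply: (gen_alg_ext (gen_alg_const X (c%:P)`_d)).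
  + by rewrite hornerC.
  + by rewrite !coefC; case: d => [|d] /=; rewrite ?mul1r ?mulr0.
- exists (fun t => p t + q t); split=> [d|t|t t' s h1 h2 d].
  + by apply: (gen_alg_ext (gen_alg_add (ap d) (aq d))) => t; rewrite coefD.
  + by rewrite hornerD ep eq.
  + by rewrite !coefD (hp t t' s) // (hq t t' s) // mulrDr.
- exists (fun t => p t * q t); split=> [d|t|t t' s h1 h2 d].
  + have : gen_alg X (fun t => \sum_(i < d.+1) (p t)`_i * (q t)`_(d - i)).
      by apply: gen_alg_sum => i _; apply: gen_alg_mul.
    by move/gen_alg_ext; apply=> t; rewrite coefM.
  + by rewrite hornerM ep eq.
  + rewrite !coefM mulr_sumr; apply: eq_bigr => i _.
    rewrite (hp t t' s) // (hq t t' s) //.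
    have hi : (i <= d)%N by rewrite -ltnS.
    have -> : s ^+ d = s ^+ i * s ^+ (d - i) by rewrite -exprD subnKC.
    ring.
- by exists p; split=> // t; rewrite -e.
Qed.

End Alg.
Arguments entry {F} a b.

(** * Semi-invariant functions on GL_k *)

Definition upper (R : pzRingType) k (g : 'M[R]_k) :=
  forall i j : 'I_k, (j < i)%N -> g i j = 0.

Section GLSemiInvariant.
Variable F : closedFieldType.

Section Invariant.
Variables (k : nat) (phi N : 'M[F]_k.+1 -> F) (q : nat).
Hypothesis pfN : polyfun N.
Hypothesis phiN : forall B, B \in unitmx -> phi B * \det B ^+ q = N B.
Hypothesis phi_upper : forall g B,
  upper g -> g \in unitmx -> B \in unitmx -> phi (g *m B) = phi B.

Let tv (i : 'I_k.+1) (s : F) : 'M[F]_k.+1 := 1%:M + s *: delta_mx i ord0.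

Let tv_mulE i s (B : 'M_k.+1) a b : (tv i s *m B) a b = B a b + s * (a == i)%:R * B ord0 b.
Proof.
rewrite mulmxDl mul1mx -scalemxAl mxE; congr (_ + _); rewrite !mxE -mulrA; congr (_ * _).
rewrite (bigD1 ord0) //= big1 ?addr0 => [|j j0]; rewrite !mxE ?eqxx ?andbT //.
by rewrite (negPf j0) andbF mul0r.
Qed.

Let tv_unit i s : i != ord0 -> tv i s \in unitmx.
Proof.
move=> i0; suff e : tv i (- s) *m tv i s = 1%:M by case: (mulmx1_unit e).
apply/matrixP => a b; rewrite tv_mulE !mxE (eq_sym ord0 i) (negPf i0) /= mulr0 addr0.
by rewrite (eq_sym b) -mulnb natrM; ring.
Qed.

(** Modulo upper triangular factors on the left, [B] and [xrow ord0 i B] are the points at 0 and at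
    infinity of one projective line, on which [phi] is regular, hence constant. *)
Lemma invariant_swap0 i B : B \in unitmx -> phi (xrow ord0 i B) = phi B.
Proof.
move=> uB; have [->|i0] := eqVneq i ord0; first by rewrite /xrow tperm1 row_perm1.
have uP : (tperm_mx ord0 i : 'M[F]_k.+1) \in unitmx by apply: unitmx_perm.
pose W := xrow ord0 i B; have uW : W \in unitmx by rewrite /W xrowE unitmx_mul uP.
(* Left multiplication by [tv i s] preserves the determinant, so the denominator of [phi] is
   constant along the curve. *)
have line C : C \in unitmx ->
    exists p : {poly F}, forall s, phi (tv i s *m C) = p.[s].
  move=> uC; have : gen_alg (coord1 (F:=F)) (fun s => N (tv i s *m C) / \det (tv i s *m C) ^+ q).
    have dC s : \det (tv i s *m C) = \det C.
      suff d1 : \det (tv i s) = 1 by rewrite det_mulmx d1 mul1r.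
      rewrite det_trig; first by rewrite big1 // => a _; rewrite !mxE eqxx;
        case: (eqVneq a i) => [->|]; rewrite ?(negPf i0) /= mulr0 addr0.
      apply/is_trig_mxP => a b ab; rewrite !mxE; case: (eqVneq a b) ab => [->|_].
        by rewrite ltnn.
      move=> ab; case: (b =P ord0) ab => [->|] // _; by rewrite andbF mulr0 addr0.
    apply: gen_alg_ext (fun s => N (tv i s *m C) * (\det C ^+ q)^-1) _ _ _; last first.
      by move=> s; rewrite dC.
    apply: gen_alg_mul; last exact: gen_alg_const.
    apply: (polyfun_comp pfN); apply: gen_algmx_mul; last exact: gen_algmx_const.
    apply: gen_algmx_add; first exact: gen_algmx_const.
    by apply: gen_algmx_scale; [apply: (gen_alg_gen _ tt)|apply: gen_algmx_const].
  case/gen_alg_poly=> p hp; exists p => s; rewrite -hp -phiN ?mulfK ?expf_neq0 //.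
    by rewrite -unitfE -unitmxE unitmx_mul tv_unit.
  by rewrite unitmx_mul tv_unit.
have [p hp] := line B uB; have [p' hp'] := line W uW.
(* For s <> 0 the matrices [1 0; s 1] and [1 0; 1/s 1][0 1; 1 0] differ by an upper
   triangular factor, so s |-> phi (tv i s *m B) is regular on the projective line. *)
have e s : s != 0 -> p.[s] = p'.[s^-1].
  move=> s0; rewrite -hp -hp'; pose g := tv i s^-1 *m (tperm_mx ord0 i *m tv i (- s)).
  have tvK : tv i (- s) *m tv i s = 1%:M.
    apply/matrixP => a b; rewrite tv_mulE !mxE (eq_sym ord0 i) (negPf i0) /= mulr0 addr0.
    by rewrite (eq_sym b) -mulnb natrM; ring.
  have -> : tv i s^-1 *m W = g *m (tv i s *m B).
    by rewrite /g /W xrowE -!mulmxA (mulmxA (tv i (- s))) tvK mul1mx.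
  rewrite [RHS]phi_upper //; last by rewrite unitmx_mul tv_unit.
    move=> a b ba; rewrite /g tv_mulE -xrowE /xrow !mxE tpermL.
    have a0 : a != ord0 by apply: contraTneq ba => ->.
    have [ai|ai] := eqVneq a i.
      have bi : i != b by rewrite -ai neq_ltn ba orbT.
      rewrite ai tpermR !(eq_sym ord0) (negPf i0) (negPf bi) eqxx /= eq_sym.
      by rewrite mulr0 addr0 mulr1 add0r mulrA mulrN mulVf // mulN1r subrr.
    rewrite tpermD ?(eq_sym ord0) // 1?eq_sym // (negPf ai) /= !mulr0 mul0r !addr0 eq_sym.
    by case: eqP ba => // ->; rewrite ltnn.
  by rewrite !unitmx_mul !tv_unit // uP.
move: (hp 0) (hp' 0); rewrite (laurent_const e) => <-.
by rewrite /tv !scale0r !addr0 !mul1mx.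
Qed.

(** [B1 *m invmx B] differs from the identity in its first row only, so it is upper triangular. *)
Lemma invariant_row0 B B1 : B \in unitmx -> B1 \in unitmx ->
  (forall a, a != ord0 -> row a B1 = row a B) -> phi B1 = phi B.
Proof.
move=> uB uB1 e; rewrite -{1}(mulmxKV uB B1); apply: phi_upper => //.
  move=> a b ba; have a0 : a != ord0 by apply: contraTneq ba => ->.
  have : row a (B1 *m invmx B) = row a 1%:M by rewrite row_mul e // -row_mul mulmxV.
  move/rowP/(_ b); rewrite !mxE => ->.
  by case: eqP ba => // ->; rewrite ltnn.
by rewrite unitmx_mul uB1 unitmx_inv.
Qed.

Lemma invariant_row i B B1 : B \in unitmx -> B1 \in unitmx ->
  (forall a, a != i -> row a B1 = row a B) -> phi B1 = phi B.
Proof.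
move=> uB uB1 e.
have uX C : C \in unitmx -> xrow ord0 i C \in unitmx.
  by move=> uC; rewrite xrowE unitmx_mul unitmx_perm.
rewrite -(invariant_swap0 i uB) -(invariant_swap0 i uB1); apply: invariant_row0; rewrite ?uX //.
move=> a a0; have ti : tperm ord0 i a != i.
  by rewrite -[X in _ != X](tpermL ord0 i) (inj_eq perm_inj).
by apply/rowP => b; move/rowP/(_ b): (e _ ti); rewrite !mxE.
Qed.

(** The rows of [B] are replaced by those of the identity one at a time. The intermediate matrices
    are invertible only where [d] is nonzero, and density carries the result to all invertible
    matrices. *)
Lemma invariant_const B : B \in unitmx -> phi B = phi 1%:M.
Proof.
pose repl (j : nat) (C : 'M[F]_k.+1) : 'M_k.+1 :=
  \matrix_(a, b) if (a < j)%N then (a == b)%:R else C a b.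
pose d C := \prod_(j < k.+2) \det (repl j C).
have uniq_val C j : (j <= k.+1)%N -> d C != 0 -> repl j C \in unitmx.
  move=> hj; rewrite unitmxE unitfE; apply: contraNneq => z.
  by rewrite /d (bigD1 (Ordinal (hj : (j < k.+2)%N))) //= z mul0r.
have repl0 C : repl 0 C = C by apply/matrixP => a b; rewrite mxE.
have chain C : d C != 0 -> forall j, (j <= k.+1)%N -> phi (repl j C) = phi C.
  move=> dC; elim=> [|j IH] hj; first by rewrite repl0.
  rewrite -(IH (ltnW hj)); apply: (@invariant_row (Ordinal hj)); try exact: uniq_val.
    exact/uniq_val/dC/ltnW.
  move=> a aj; apply/rowP => b; rewrite !mxE ltnS leq_eqVlt.
  by rewrite -val_eqE /= in aj; rewrite (negPf aj).
have pfd : polyfun d.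
  apply: gen_alg_prod => j _; apply: gen_alg_det => a b.
  case aj: (a < j)%N.
    by apply: (gen_alg_ext (gen_alg_const _ (a == b)%:R)) => C; rewrite mxE aj.
  by apply: (gen_alg_ext (gen_alg_gen _ (a, b))) => C; rewrite mxE aj.
have d1 : d 1%:M != 0.
  apply/prodf_neq0 => j _; suff -> : repl j 1%:M = 1%:M by rewrite det1 oner_neq0.
  by apply/matrixP => a b; rewrite !mxE; case: ifP.
have E : N =1 (fun C => phi 1%:M * \det C ^+ q).
  apply: (polyfun_density pfd pfN _ d1).
    by apply: gen_alg_scale; apply: gen_alg_exp; apply: gen_alg_det; apply: gen_algmx_id.
  move=> C dC; have uC : C \in unitmx by rewrite -(repl0 C) uniq_val.
  rewrite -phiN // -(chain C dC k.+1) //; congr (phi _ * _).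
  by apply/matrixP => a b; rewrite !mxE ltn_ord.
move=> uB; have dq : \det B ^+ q != 0 by rewrite expf_neq0 // -unitfE -unitmxE.
by apply: (mulIf dq); rewrite phiN // E.
Qed.

End Invariant.

(** Dividing [phi] by the [r]-th power of the determinant gives an invariant function, which is
    constant; the denominator exponent grows to [q + r]. *)
Lemma GL_semi_invariant k (phi N : 'M[F]_k -> F) (q r : nat) :
  polyfun N -> (forall B, B \in unitmx -> phi B * \det B ^+ q = N B) ->
  (forall g B, upper g -> g \in unitmx -> B \in unitmx ->
     phi (g *m B) = \det g ^+ r * phi B) ->
  forall B, B \in unitmx -> phi B = \det B ^+ r * phi 1%:M.
Proof.
case: k phi N => [|k] phi N pfN phiN phi_upper B uB.
  by rewrite (flatmx0 B) det_mx00 expr1n mul1r (flatmx0 1%:M).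
have nz (C : 'M[F]_k.+1) : C \in unitmx -> \det C ^+ r != 0.
  by move=> uC; rewrite expf_neq0 // -unitfE -unitmxE.
have := @invariant_const k (fun C => phi C / \det C ^+ r) N (q + r) pfN _ _ B uB.
rewrite det1 expr1n divr1 => <-; first by rewrite mulrC divfK ?nz.
  by move=> C uC; rewrite addnC exprD mulrA divfK ?nz // phiN.
move=> g C ug uug uC; rewrite phi_upper // det_mulmx exprMn -mulf_div divff ?nz //.
by rewrite mul1r.
Qed.

End GLSemiInvariant.

(** * The adjugate of 1 + z x *)

Section PrincipalMinors.
Variable R : comNzRingType.

Lemma det_mxsub_inj n (g : 'I_n -> 'I_n) (M : 'M[R]_n) :
  injective g -> \det (mxsub g g M) = \det M.
Proof.
move=> gI; have -> : mxsub g g M = perm_mx (perm gI) *m M *m (perm_mx (perm gI))^T.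
  rewrite tr_perm_mx -row_permE -col_permE; apply/matrixP => i j.
  by rewrite !mxE !permE.
by rewrite !det_mulmx det_tr mulrAC det_perm -expr2 sqrr_sign mul1r.
Qed.

(** This form is for the dimension [#|J| + #|~: J|], which equals [n] only propositionally. *)
Lemma det_mxsub_cast n n' (e : n' = n) (g : 'I_n' -> 'I_n) (M : 'M[R]_n) :
  injective g -> \det (mxsub g g M) = \det M.
Proof. by subst n'; apply: det_mxsub_inj. Qed.

Definition pminor n (M : 'M[R]_n) (J : {set 'I_n}) : 'M[R]_#|J| :=
  \matrix_(a, b) M (enum_val (A := mem J) a) (enum_val (A := mem J) b).

(** Listing the indices in [J] first makes the matrix block upper triangular, with an identity as
    second diagonal block. *)
Lemma det_pminor n (M : 'M[R]_n) (J : {set 'I_n}) :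
  \det (\matrix_(i, j) if i \in J then M i j else (i == j)%:R) = \det (pminor M J).
Proof.
pose g (k : 'I_(#|J| + #|~: J|)) : 'I_n :=
  match split k with inl a => enum_val a | inr b => enum_val b end.
have gl a : g (lshift _ a) = enum_val a.
  by rewrite /g (unsplitK (inl a)).
have gr b : g (rshift _ b) = enum_val b.
  by rewrite /g (unsplitK (inr b)).
have vl (a : 'I_#|J|) : enum_val a \in J by apply: enum_valP.
have vr (b : 'I_#|~: J|) : enum_val b \notin J.
  by have := enum_valP b; rewrite inE.
have gI : injective g.
  move=> x y; case: (split_ordP x) => a ->; case: (split_ordP y) => b ->;
    rewrite ?gl ?gr => e.
  - by rewrite (enum_val_inj e).
  - by have := vl a; rewrite e (negPf (vr b)).
  - by have := vl b; rewrite -e (negPf (vr a)).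
  - by rewrite (enum_val_inj e).
have hn : (#|J| + #|~: J|)%N = n by rewrite cardsC card_ord.
rewrite -(det_mxsub_cast hn _ gI) -[mxsub _ _ _]submxK.
have -> : dlsubmx (mxsub g g (\matrix_(i, j) if i \in J then M i j else (i == j)%:R)) = 0.
  apply/matrixP => a b; rewrite !mxE gl gr (negPf (vr a)).
  by case: eqP => // e; have := vl b; rewrite -e (negPf (vr a)).
rewrite det_ublock [X in _ * \det X](_ : _ = 1%:M) ?det1 ?mulr1.
  by congr (\det _); apply/matrixP => a b; rewrite !mxE !gl vl.
apply/matrixP => a b; rewrite !mxE !gr (negPf (vr a)).
by rewrite (inj_eq enum_val_inj).
Qed.

End PrincipalMinors.

Section Pencil.
Variable R : comNzRingType.

Definition pencil n (A : 'M[R]_n) : 'M[{poly R}]_n := 1%:M + 'X *: map_mx polyC A.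

(** In the Leibniz formula every product is expanded over the set [J] of rows where the term with
    ['X] is chosen; the terms for a fixed [J] add up to ['X^#|J|] times a principal minor. *)
Lemma det_pencil_coef n (A : 'M[R]_n) j :
  (\det (pencil A))`_j = \sum_(J : {set 'I_n} | #|J| == j) \det (pminor A J).
Proof.
have -> : \det (pencil A) = \sum_(J : {set 'I_n}) 'X^#|J| * (\det (pminor A J))%:P.
  rewrite /determinant.
  under eq_bigr => s _.
    under eq_bigr => i _ do rewrite /pencil [_ (s i)]mxE addrC.
    rewrite bigA_distr mulr_sumr; over.
  rewrite exchange_big; apply: eq_bigr => J _.
  transitivity (\det (\matrix_(i, j) if i \in J then ('X *: map_mx polyC A) i j
                                     else (i == j)%:R)).
    apply: eq_bigr => s _; congr (_ * _); apply: eq_bigr => i _.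
    by rewrite [RHS]mxE; case: ifP => // _; rewrite !mxE.
  rewrite det_pminor; have -> : pminor ('X *: map_mx polyC A) J
      = 'X *: map_mx polyC (pminor A J).
    by apply/matrixP => a b; rewrite !mxE.
  by rewrite detZ det_map_mx.
rewrite coef_sum [RHS]big_mkcond; apply: eq_bigr => J _.
by rewrite coefMC coefXn eq_sym; case: eqP => _; rewrite ?mul1r ?mul0r.
Qed.

End Pencil.

Lemma mxDE (V : nmodType) a b (M N : 'M[V]_(a, b)) i j : (M + N) i j = M i j + N i j.
Proof. by rewrite mxE. Qed.

Lemma scalar_mxE (R : pzSemiRingType) n (c : R) i j : (c%:M : 'M_n) i j = c *+ (i == j).
Proof. by rewrite mxE. Qed.

(** * Coefficients of the adjugate and the companion form *)

Section Krylov.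
Variable F : fieldType.

Definition char_coef n (A : 'M[F]_n) j := (\det (pencil A))`_j.
Definition adj_coef n (A : 'M[F]_n) j : 'M[F]_n := \matrix_(a, b) (\adj (pencil A) a b)`_j.
(* By [ev_dxi_s] below the (i, j) entry is the derivative of s_(j+1) with respect to
   xi_(1, i+1). *)
Definition krylov n (A : 'M[F]_n.+1) : 'M[F]_n.+1 := \matrix_(i, j) adj_coef A j i ord0.
(** First row [c] and entries [-1] just below the diagonal: the matrix of [A] with respect to the
    columns of [krylov A], for [c = char_coefs A]. *)
Definition compan n (c : 'rV[F]_n.+1) : 'M[F]_n.+1 :=
  \matrix_(i, j) ((i == ord0)%:R * c ord0 j - (i == j.+1 :> nat)%:R).
Definition char_coefs n (A : 'M[F]_n.+1) : 'rV[F]_n.+1 := \row_j char_coef A j.+1.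

Lemma pencil_mulE n (A : 'M[F]_n) : pencil A *m \adj (pencil A)
  = \adj (pencil A) + 'X *: (map_mx polyC A *m \adj (pencil A)).
Proof. by rewrite mulmxDl mul1mx scalemxAl. Qed.

Lemma adj_coef_mul n (A : 'M[F]_n) j a b :
  ((map_mx polyC A *m \adj (pencil A)) a b)`_j = (A *m adj_coef A j) a b.
Proof.
rewrite !mxE coef_sum; apply: eq_bigr => k _.
by rewrite !mxE coefCM.
Qed.

(** Compare the coefficients of degree [j.+1] in the product of [1 + z A] with its adjugate, which
    is the scalar matrix of the determinant. *)
Lemma adj_coef_rec n (A : 'M[F]_n) j : adj_coef A j.+1 + A *m adj_coef A j = (char_coef A j.+1)%:M.
Proof.
apply/matrixP => a b.
have := congr1 (fun M : 'M[{poly F}]_n => (M a b)`_j.+1) (mul_mx_adj (pencil A)).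
rewrite /= pencil_mulE mxDE coefD [X in _ + X](_ : _ = (A *m adj_coef A j) a b); last first.
  by rewrite mxE coefXM /= adj_coef_mul.
by rewrite !scalar_mxE coefMn => <-; rewrite mxDE; congr (_ + _); rewrite mxE.
Qed.

Lemma adj_coef0 n (A : 'M[F]_n) : adj_coef A 0 = (char_coef A 0)%:M.
Proof.
apply/matrixP => a b.
have := congr1 (fun M : 'M[{poly F}]_n => (M a b)`_0) (mul_mx_adj (pencil A)).
rewrite /= pencil_mulE mxDE coefD [X in _ + X](_ : _ = 0) ?addr0; last by rewrite mxE coefXM.
by rewrite !scalar_mxE coefMn => <-; rewrite mxE.
Qed.

Lemma char_coef0 n (A : 'M[F]_n) : char_coef A 0 = 1.
Proof.
rewrite /char_coef det_pencil_coef (big_pred1 set0) => [|J]; last by rewrite cards_eq0.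
have : #|(set0 : {set 'I_n})| = 0%N by rewrite cards0.
by move: (pminor A set0) => M e; move: M; rewrite e => M; rewrite det_mx00.
Qed.

(** The adjugate consists of signed minors of size [n - 1], whose entries have degree at most 1. *)
Lemma adj_coef_big n (A : 'M[F]_n) : (0 < n)%N -> adj_coef A n = 0.
Proof.
case: n A => // n A _; apply/matrixP => a b; rewrite [RHS]mxE mxE nth_default //.
rewrite mxE /cofactor size_Msign; apply: (leq_trans (size_sum _ _ _)).
apply/bigmax_leqP => s _; rewrite size_Msign.
apply: (leq_trans (size_poly_prod_leq _ _)).
have hs : (\sum_(i < n) size ((row' b (col' a (pencil A))) i (s i)) <= \sum_(i < n) 2)%N.
  apply: leq_sum => i _; rewrite !mxE; apply: (leq_trans (size_polyD _ _)).
  rewrite geq_max; apply/andP; split.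
    by case: (_ == _); rewrite ?size_poly1 ?size_poly0.
  apply: (leq_trans (size_polyMleq _ _)); rewrite size_polyX.
  by rewrite add2n /= ltnS size_polyC_leq1.
rewrite leq_subLR (_ : #|_| = n); last by rewrite -[RHS]card_ord.
by move: hs; rewrite sum_nat_const card_ord muln2 -addnn addnS ltnS.
Qed.

Lemma krylov_col0 n (A : 'M[F]_n.+1) i : krylov A i ord0 = (i == ord0)%:R.
Proof. by rewrite mxE adj_coef0 char_coef0 mxE. Qed.

Lemma krylovE n (A : 'M[F]_n.+1) : A *m krylov A = krylov A *m compan (char_coefs A).
Proof.
apply/matrixP => i j.
have -> : (A *m krylov A) i j = (A *m adj_coef A j) i ord0.
  by rewrite !mxE; apply: eq_bigr => k _; rewrite !mxE.
have := congr1 (fun M : 'M[F]_n.+1 => M i ord0) (adj_coef_rec A j).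
rewrite /= mxDE scalar_mxE => e.
rewrite -(addKr (adj_coef A j.+1 i ord0) ((A *m _) i ord0)) e [RHS]mxE.
under eq_bigr => k _ do rewrite [compan _ k j]mxE mulrBr.
rewrite sumrB addrC -mulr_natr; congr (_ - _).
  rewrite (bigD1 ord0) //= big1 ?addr0 => [|k k0].
    by rewrite krylov_col0 mul1r mxE mulrC.
  by rewrite (negPf k0) mul0r mulr0.
(* In the last column the recursion would call for one more column, which is zero by
   [adj_coef_big]. *)
have [hj|hj] := ltnP j.+1 n.+1.
  rewrite (bigD1 (Ordinal hj)) //= big1 ?addr0 => [|k k0]; first by rewrite eqxx mulr1 [RHS]mxE.
  by rewrite -val_eqE /= in k0; rewrite (negPf k0) mulr0.
have ej : j.+1 = n.+1 by apply/eqP; rewrite eqn_leq ltn_ord hj.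
rewrite ej adj_coef_big // mxE big1 // => k _.
by rewrite (ltn_eqF (ltn_ord k)) mulr0.
Qed.

Lemma pencil_det_neq0 n (A : 'M[F]_n) : \det (pencil A) != 0.
Proof.
apply/eqP => e; have := char_coef0 A; rewrite /char_coef e coef0 => /esym /eqP.
by rewrite oner_eq0.
Qed.

(** The determinant of the pencil is nonzero, its constant coefficient being 1, so it cancels over
    the domain of polynomials. Adjugates are identified below by this criterion. *)
Lemma pencil_adj_uniq n (A : 'M[F]_n) M :
  pencil A *m M = (\det (pencil A))%:M -> M = \adj (pencil A).
Proof.
move=> e; have : \adj (pencil A) *m (pencil A *m M)
    = \adj (pencil A) *m (pencil A *m \adj (pencil A)) by rewrite e mul_mx_adj.
rewrite !mulmxA mul_adj_mx !mul_scalar_mx => /matrixP h; apply/matrixP => a b.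
by have := h a b; rewrite !mxE => /(mulfI (pencil_det_neq0 A)).
Qed.

Lemma map_polyC_mulmx a b c (M : 'M[F]_(a, b)) (N : 'M_(b, c)) :
  map_mx polyC (M *m N) = map_mx polyC M *m map_mx polyC N.
Proof. exact: (map_mxM polyC). Qed.

Lemma pencil_conj n (g A : 'M[F]_n) : g \in unitmx ->
  pencil (g *m A *m invmx g) = map_mx polyC g *m pencil A *m map_mx polyC (invmx g).
Proof.
move=> ug; rewrite /pencil mulmxDr mulmx1 mulmxDl -map_polyC_mulmx mulmxV // map_mx1.
by rewrite -scalemxAr -scalemxAl !map_polyC_mulmx.
Qed.

Lemma det_pencil_conj n (g A : 'M[F]_n) : g \in unitmx ->
  \det (pencil (g *m A *m invmx g)) = \det (pencil A).
Proof.
move=> ug; rewrite pencil_conj // !det_mulmx mulrAC -det_mulmx -map_polyC_mulmx.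
by rewrite mulmxV // map_mx1 det1 mul1r.
Qed.

Lemma char_coef_conj n (g A : 'M[F]_n) j : g \in unitmx ->
  char_coef (g *m A *m invmx g) j = char_coef A j.
Proof. by move=> ug; rewrite /char_coef det_pencil_conj. Qed.

Lemma adj_coef_map n (g h A : 'M[F]_n) j a b :
  ((map_mx polyC g *m \adj (pencil A) *m map_mx polyC h) a b)`_j = (g *m adj_coef A j *m h) a b.
Proof.
rewrite !mxE coef_sum; apply: eq_bigr => k _.
rewrite [map_mx polyC h k b]mxE coefMC; congr (_ * _).
rewrite !mxE coef_sum; apply: eq_bigr => l _.
by rewrite [map_mx polyC g a l]mxE coefCM [adj_coef _ _ _ _]mxE.
Qed.

Lemma adj_coef_conj n (g A : 'M[F]_n) j : g \in unitmx ->
  adj_coef (g *m A *m invmx g) j = g *m adj_coef A j *m invmx g.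
Proof.
move=> ug; apply/matrixP => a b; rewrite -adj_coef_map [LHS]mxE.
congr ((_ : 'M[{poly F}]_n) a b)`_j; apply/esym/pencil_adj_uniq.
rewrite det_pencil_conj // pencil_conj // !mulmxA.
rewrite -(mulmxA _ _ (map_mx polyC g)) -map_polyC_mulmx mulVmx // map_mx1 mulmx1.
rewrite -(mulmxA _ (pencil A)) mul_mx_adj mul_mx_scalar -scalemxAl -map_polyC_mulmx.
by rewrite mulmxV // map_mx1 scalemx1.
Qed.

(** The adjugate of the pencil is conjugated by [g], and the inverse of [g] sends the first basis
    vector to [c^-1] times itself. *)
Lemma krylov_conj n (g A : 'M[F]_n.+1) c : g \in unitmx ->
  (forall i, g i ord0 = c * (i == ord0)%:R) ->
  krylov (g *m A *m invmx g) = c^-1 *: (g *m krylov A).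
Proof.
move=> ug g0.
have gd : g *m delta_mx ord0 (ord0 : 'I_1) = c *: delta_mx ord0 ord0.
  apply/matrixP => i j; rewrite (ord1 j) -colE !mxE g0.
  by rewrite andbT.
have c0 : c != 0.
  apply/eqP => z; move: gd; rewrite z scale0r => /(congr1 (mulmx (invmx g))).
  rewrite mulKmx // mulmx0 => /matrixP/(_ ord0 ord0)/eqP.
  by rewrite !mxE eqxx oner_eq0.
have hV i : invmx g i ord0 = c^-1 * (i == ord0)%:R.
  have : invmx g *m delta_mx ord0 (ord0 : 'I_1) = c^-1 *: delta_mx ord0 ord0.
    by rewrite -[LHS](scalerKV (invr_neq0 c0)) ?invrK // scalemxAr -gd mulKmx.
  rewrite -colE => /matrixP/(_ i ord0); rewrite !mxE => ->.
  by rewrite andbT.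
apply/matrixP => i j; rewrite [LHS]mxE adj_coef_conj // mxE (bigD1 ord0) //= big1 ?addr0.
  rewrite hV eqxx mulr1 mulrC !mxE; congr (_ * _); apply: eq_bigr => k _.
  by rewrite !mxE.
by move=> k k0; rewrite hV (negPf k0) !mulr0.
Qed.

(** This matrix is the base point of the density arguments. Its pencil is lower unitriangular, so
    the recursion reduces to shifting basis vectors. *)
Lemma krylov_compan0 n : krylov (compan (0 : 'rV[F]_n.+1)) = 1%:M.
Proof.
set A := compan 0; have AE i j : A i j = - (i == j.+1 :> nat)%:R.
  by rewrite mxE mxE mulr0 add0r.
have dA : \det (pencil A) = 1.
  rewrite det_trig; first rewrite big1 // => i _.
    by rewrite !mxE eqxx mulr0 add0r ltn_eqF // oppr0 mulr0 addr0.
  apply/is_trig_mxP => i j ij; rewrite !mxE -val_eqE /= (ltn_eqF ij) mulr0 add0r.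
  by rewrite (ltn_eqF (ltnW (ij : (i.+1 <= j)%N) : (i < j.+1)%N)) subrr mulr0.
have sA j : char_coef A j.+1 = 0 by rewrite /char_coef dA coef1.
suff h : forall j (hj : (j < n.+1)%N) i, adj_coef A j i ord0 = (i == j :> nat)%:R.
  by apply/matrixP => i j; rewrite mxE h // mxE -val_eqE.
elim=> [|j IH] hj i; first by rewrite adj_coef0 char_coef0 mxE -val_eqE.
have := congr1 (fun M : 'M[F]_n.+1 => M i ord0) (adj_coef_rec A j).
rewrite /= sA mxDE scalar_mxE mul0rn => /eqP.
rewrite addr_eq0 => /eqP ->; rewrite mxE (bigD1 (Ordinal (ltnW hj))) //= big1 ?addr0.
  by rewrite AE IH ?(ltnW hj) //= eqxx mulr1 opprK.
by move=> k kj; rewrite IH ?(ltnW hj) // -val_eqE /= in kj *; rewrite (negPf kj) mulr0.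
Qed.

(** Expand along row [a]: its cofactors do not involve the modified entry. *)
Lemma det_add_delta (R : comNzRingType) n (M : 'M[R]_n) a b d :
  \det (M + d *: delta_mx a b) = \det M + d * cofactor M a b.
Proof.
rewrite (expand_det_row _ a) (expand_det_row M a).
have cE j : cofactor (M + d *: delta_mx a b) a j = cofactor M a j.
  rewrite /cofactor; congr (_ * \det _); apply/matrixP => k l; rewrite !mxE.
  by rewrite eq_sym (negPf (neq_lift _ _)) /= mulr0 addr0.
under eq_bigr => j _ do rewrite cE mxE mulrDl.
rewrite big_split /=; congr (_ + _); rewrite (bigD1 b) //= big1 ?addr0 => [|j jb].
  by rewrite !mxE !eqxx mulr1.
by rewrite !mxE (negPf jb) andbF mulr0 mul0r.
Qed.

Lemma char_coef_add_delta n (A : 'M[F]_n) a b e j :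
  char_coef (A + e *: delta_mx a b) j.+1 = char_coef A j.+1 + e * adj_coef A j b a.
Proof.
rewrite /char_coef; have -> : pencil (A + e *: delta_mx a b)
    = pencil A + ('X * e%:P) *: delta_mx a b.
  apply/matrixP => i k; rewrite !mxE polyCD polyCM mulrDr addrA mulrA.
  by case: (_ && _).
by rewrite det_add_delta coefD -mulrA coefXM /= coefCM !mxE.
Qed.

(** Reflection in the antidiagonal, an anti-automorphism of the matrix algebra that keeps upper
    triangular matrices upper triangular. *)
Definition antitr (R : Type) n (A : 'M[R]_n) : 'M[R]_n := \matrix_(i, j) A (rev_ord j) (rev_ord i).

Lemma antitrK (R : Type) n : involutive (@antitr R n).
Proof. by move=> A; apply/matrixP => i j; rewrite !mxE !rev_ordK. Qed.

Lemma antitr_mul (R : comNzRingType) n (A B : 'M[R]_n) : antitr (A *m B) = antitr B *m antitr A.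
Proof.
apply/matrixP => i j; rewrite !mxE [RHS](reindex_inj rev_ord_inj).
by apply: eq_bigr => k _; rewrite !mxE rev_ordK mulrC.
Qed.

Lemma det_antitr (R : comNzRingType) n (A : 'M[R]_n) : \det (antitr A) = \det A.
Proof.
rewrite -(det_mxsub_inj A (@rev_ord_inj n)) -det_tr; congr (\det _).
by apply/matrixP => i j; rewrite !mxE.
Qed.

Lemma antitr1 (R : comNzRingType) n : antitr (1%:M : 'M[R]_n) = 1%:M.
Proof. by apply/matrixP => i j; rewrite !mxE (inj_eq rev_ord_inj) eq_sym. Qed.

Lemma pencil_antitr n (A : 'M[F]_n) : pencil (antitr A) = antitr (pencil A).
Proof. by apply/matrixP => i j; rewrite !mxE (inj_eq rev_ord_inj) eq_sym. Qed.

Lemma adj_coef_antitr n (A : 'M[F]_n) j : adj_coef (antitr A) j = antitr (adj_coef A j).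
Proof.
have E : antitr (\adj (pencil A)) = \adj (pencil (antitr A)).
  apply: pencil_adj_uniq; rewrite pencil_antitr -antitr_mul mul_adj_mx det_antitr.
  by apply/matrixP => i k; rewrite !mxE (inj_eq rev_ord_inj) eq_sym.
by apply/matrixP => a b; rewrite [LHS]mxE -E !mxE.
Qed.

End Krylov.

(** * Evaluation of polynomials on matrices *)

Lemma mpoly_ring_ind (R : comNzRingType) n (P : {mpoly R[n]} -> Prop) :
  (forall c, P c%:MP) -> (forall i, P 'X_i) -> (forall p q, P p -> P q -> P (p + q)) ->
  (forall p q, P p -> P q -> P (p * q)) -> forall p, P p.
Proof.
move=> hC hX hD hM; elim/mpolyind => [|c m p _ _ hp]; first by rewrite -mpolyC0.
apply: (hD _ _ _ hp); rewrite -mul_mpolyC; apply: (hM _ _ (hC _)).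
rewrite mpolyXE_id; elim/big_rec: _ => [|i q _ hq]; first by rewrite -mpolyC1.
apply: (hM _ _ _ hq); elim: (m i) => [|k IH]; first by rewrite expr0 -mpolyC1.
by rewrite exprS; apply: hM.
Qed.

(** Uniqueness of digits in base [D]: the remainder modulo [D] gives the lowest digit, and the
    quotient is treated by induction. *)
Lemma sum_base_inj n D (f g : 'I_n -> nat) :
  (forall i, f i < D)%N -> (forall i, g i < D)%N ->
  (\sum_(i < n) f i * D ^ i = \sum_(i < n) g i * D ^ i)%N -> f =1 g.
Proof.
elim: n f g => [|n IH] f g hf hg; first by move=> _ [].
have step h : (\sum_(i < n.+1) h i * D ^ i =
    (\sum_(i < n) h (lift ord0 i) * D ^ i) * D + h ord0)%N.
  rewrite big_ord_recl expn0 muln1 addnC big_distrl; congr (_ + _)%N.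
  by apply: eq_bigr => i _; rewrite /= /bump /= add1n expnSr mulnA.
rewrite !step => e.
have e0 : f ord0 = g ord0.
  by have := congr1 (modn^~ D) e; rewrite /= !modnMDl !modn_small.
have D0 : (0 < D)%N by apply: leq_ltn_trans (hf ord0).
have e1 : (\sum_(i < n) f (lift ord0 i) * D ^ i = \sum_(i < n) g (lift ord0 i) * D ^ i)%N.
  move/eqP: e; rewrite e0 eqn_add2r eqn_pmul2r // => /eqP ->//.
move=> i; case: (unliftP ord0 i) => [j|] -> //.
by apply: (IH (fun j => f (lift ord0 j)) (fun j => g (lift ord0 j))).
Qed.

(* Kronecker substitution reduces this to one variable. *)
Lemma mpoly_eq0_ext (F : closedFieldType) n (p : {mpoly F[n]}) :
  (forall v, p.@[v] = 0) -> p = 0.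
Proof.
move=> h; pose D := msize p; pose k (m : 'X_{1..n}) := (\sum_(i < n) m i * D ^ i)%N.
have bnd (m : 'X_{1..n}) i : m \in msupp p -> (m i < D)%N.
  move=> /msize_mdeg_lt; apply: leq_ltn_trans.
  by rewrite mdegE (bigD1 i) //= leq_addr.
have q0 : \sum_(m <- msupp p) p@_m *: 'X^(k m) = 0 :> {poly F}.
  apply: poly_eq_ext => x; rewrite horner0 -(h (fun i => x ^+ (D ^ i))) mevalE horner_sum.
  apply: eq_bigr => m _; rewrite hornerZ hornerXn; congr (_ * _).
  rewrite /k -prodrXr; apply: eq_bigr => i _.
  by rewrite -exprM mulnC.
apply/mpolyP => m; rewrite mcoeff0; case: (boolP (m \in msupp p)) => [mp|]; last first.
  by rewrite mcoeff_msupp negbK => /eqP.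
have := congr1 (fun q : {poly F} => q`_(k m)) q0; rewrite /= coef0 coef_sum => <-.
rewrite (bigD1_seq m) ?msupp_uniq //= coefZ coefXn eqxx mulr1 big_seq_cond big1 ?addr0 //.
move=> m' /andP[m'p m'm]; rewrite coefZ coefXn; case: eqP => [e|]; last by rewrite mulr0.
case/eqP: m'm; apply/mnmP => i; apply: (sum_base_inj (D := D)) i => [i|i|]; try exact: bnd.
exact/esym/e.
Qed.

Section Evaluation.
Variable F : closedFieldType.

Definition ev n (f : kg F n) (A : 'M[F]_n) : F := f.@[fun i => mxvec A ord0 i].

Section Ev.
Variable n : nat.
Implicit Types f g : kg F n.

Lemma evD f g A : ev (f + g) A = ev f A + ev g A. Proof. exact: mevalD. Qed.
Lemma evM f g A : ev (f * g) A = ev f A * ev g A. Proof. exact: mevalM. Qed.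
Lemma evC c A : ev (n := n) c%:MP A = c. Proof. exact: mevalC. Qed.
Lemma evZ c f A : ev (c *: f) A = c * ev f A. Proof. exact: mevalZ. Qed.
Lemma ev_xi (i j : 'I_n) A : ev (xi F i j) A = A i j.
Proof. by rewrite /ev mevalXU mxvecE. Qed.
Lemma ev_sum I (s : seq I) (P : pred I) (h : I -> kg F n) A :
  ev (\sum_(i <- s | P i) h i) A = \sum_(i <- s | P i) ev (h i) A.
Proof. exact: raddf_sum. Qed.
Lemma ev_det k (M : 'M[kg F n]_k) A :
  ev (\det M) A = \det (\matrix_(i, j) ev (M i j) A).
Proof.
rewrite /ev -(det_map_mx (meval (fun i => mxvec A ord0 i))).
by congr (\det _); apply/matrixP => i j; rewrite !mxE.
Qed.

Lemma ev_inj f g : ev f =1 ev g -> f = g.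
Proof.
move=> e; apply/eqP; rewrite -subr_eq0; apply/eqP/mpoly_eq0_ext => v.
rewrite mevalB; apply/eqP; rewrite subr_eq0; apply/eqP.
have ve : v =1 (fun i => mxvec (vec_mx (\row_i v i)) ord0 i) by move=> i; rewrite vec_mxK mxE.
rewrite !(meval_eq _ ve); exact: e.
Qed.

Lemma ev_polyfun f : polyfun (ev f).
Proof.
elim/mpoly_ring_ind: f => [c|i|f g hf hg|f g hf hg].
- by apply: (gen_alg_ext (gen_alg_const _ c)) => A; rewrite evC.
- case/mxvec_indexP: i => i j.
  by apply: (gen_alg_ext (gen_alg_gen _ (i, j))) => A; rewrite -[LHS]ev_xi.
- by apply: (gen_alg_ext (gen_alg_add hf hg)) => A; rewrite evD.
- by apply: (gen_alg_ext (gen_alg_mul hf hg)) => A; rewrite evM.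
Qed.

Lemma ev_act (g : 'M[F]_n) f A : ev (act g f) A = ev f (invmx g *m A *m g).
Proof.
pose v i := mxvec A ord0 i.
pose M := map_mx (@mpolyC _ F) (invmx g) *m Defs.genmx F n *m map_mx (@mpolyC _ F) g.
have EM : map_mx (meval v) M = invmx g *m A *m g.
  rewrite !map_mxM -!map_mx_comp; congr (_ *m _ *m _); apply/matrixP => i j;
    rewrite !mxE /= ?mevalC //; exact: ev_xi.
rewrite /ev /act comp_mpoly_meval; apply: meval_eq => i; rewrite tnth_mktuple.
by case/mxvec_indexP: i => i j; rewrite !mxvecE -EM [RHS]mxE.
Qed.

Lemma ev_s_inv j A : ev (s_inv F n j) A = char_coef A j.
Proof.
rewrite /char_coef det_pencil_coef ev_sum; apply: eq_bigr => J _; rewrite ev_det.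
by congr (\det _); apply/matrixP => a b; rewrite !mxE ev_xi.
Qed.

(** The formal derivative is read off as the linear coefficient along the line through [A] in
    direction [delta_mx a b]; the constant coefficient is recorded to make the product rule go
    through. *)
Lemma ev_dxi a b f A : exists p : {poly F},
  [/\ forall e, ev f (A + e *: delta_mx a b) = p.[e], p`_0 = ev f A &
      p`_1 = ev (dxi a b f) A].
Proof.
elim/mpoly_ring_ind: f => [c|i|f g [p [p1 p2 p3]] [q [q1 q2 q3]]
    |f g [p [p1 p2 p3]] [q [q1 q2 q3]]].
- exists c%:P; split=> [e||]; first by rewrite hornerC evC.
    by rewrite coefC evC.
  by rewrite coefC /dxi mderivC -mpolyC0 evC.
- case/mxvec_indexP: i => i j; rewrite -/(xi F i j).
  exists ((A i j)%:P + ((i == a) && (j == b))%:R *: 'X); split=> [e||].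
  + by rewrite ev_xi !mxE hornerD hornerC hornerZ hornerX mulrC.
  + by rewrite coefD coefC coefZ coefX mulr0 addr0 ev_xi.
  + rewrite coefD coefC coefZ coefX mulr1 add0r /dxi mderivX mnm1E.
    have -> : (mxvec_index i j == mxvec_index a b) = (i == a) && (j == b).
      have [h hK _] := @curry_mxvec_bij n n.
      have mI : injective (uncurry (@mxvec_index n n)).
        by apply: (can_inj (g := h)) => x; apply: hK.
      exact: (inj_eq mI (i, j) (a, b)).
    case: andP => [[/eqP -> /eqP ->]|_]; last by rewrite scale0r -mpolyC0 evC.
    have -> : (U_(mxvec_index a b) - U_(mxvec_index a b) = 0 :> 'X_{1..(n * n)})%MM.
      by apply/mnmP => k; rewrite !mnmE subnn.
    by rewrite mpolyX0 evZ -mpolyC1 evC mulr1.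
- exists (p + q); split=> [e||].
  + by rewrite evD hornerD p1 q1.
  + by rewrite evD coefD p2 q2.
  + by rewrite coefD p3 q3 /dxi mderivD evD.
- exists (p * q); split=> [e||].
  + by rewrite evM hornerM p1 q1.
  + by rewrite evM coefM big_ord1 p2 q2.
  + rewrite coefM big_ord_recl big_ord1 /= /bump /= subn0 p2 q2 p3 q3.
    by rewrite /dxi mderivM evD !evM addrC.
Qed.

Lemma ev_dxi_s a b j A : ev (dxi a b (s_inv F n j.+1)) A = adj_coef A j b a.
Proof.
have [p [p1 p2 <-]] := ev_dxi a b (s_inv F n j.+1) A.
suff -> : p = (char_coef A j.+1)%:P + adj_coef A j b a *: 'X.
  by rewrite coefD coefC coefZ coefX mulr1 add0r.
apply: poly_eq_ext => e; rewrite -p1 ev_s_inv char_coef_add_delta.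
by rewrite hornerD hornerC hornerZ hornerX mulrC.
Qed.

Lemma G_invariantP f : G_invariant f <->
  forall g A : 'M[F]_n, g \in unitmx -> ev f (g *m A *m invmx g) = ev f A.
Proof.
split=> h g; last first.
  move=> ug; apply: ev_inj => A; rewrite ev_act.
  by rewrite -[in RHS](h (invmx g)) ?unitmx_inv // invmxK.
move=> A ug; have := h (invmx g); rewrite /GLn unitmx_inv => /(_ ug) e.
by rewrite -[in RHS]e ev_act invmxK.
Qed.

Lemma G_invariant_s j : G_invariant (s_inv F n j).
Proof. by apply/G_invariantP => g A ug; rewrite !ev_s_inv char_coef_conj. Qed.

Lemma G_invariant_C c : G_invariant (c%:MP : kg F n).
Proof. by apply/G_invariantP => g A _; rewrite !evC. Qed.

Lemma G_invariant_D f g : G_invariant f -> G_invariant g -> G_invariant (f + g).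
Proof.
move=> /G_invariantP hf /G_invariantP hg; apply/G_invariantP => x A ux.
by rewrite !evD hf // hg.
Qed.

Lemma G_invariant_M f g : G_invariant f -> G_invariant g -> G_invariant (f * g).
Proof.
move=> /G_invariantP hf /G_invariantP hg; apply/G_invariantP => x A ux.
by rewrite !evM hf // hg.
Qed.

Lemma det_upper (g : 'M[F]_n) : upper g -> \det g = \prod_i g i i.
Proof.
move=> ug; rewrite -det_tr det_trig; first by apply: eq_bigr => i _; rewrite mxE.
by apply/is_trig_mxP => i j ij; rewrite mxE ug.
Qed.

Lemma unitri_upper (g : 'M[F]_n) : unitri g -> upper g /\ g \in unitmx.
Proof.
move=> hg; have ug : upper g by move=> i j; case: (hg i j).
by split=> //; rewrite unitmxE det_upper // big1 ?unitr1 // => i _; case: (hg i i) => _ ->.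
Qed.

Lemma invmx_upper (g : 'M[F]_n) : upper g -> g \in unitmx ->
  torus (fun i => g i i).
Proof.
move=> hg; rewrite unitmxE unitfE det_upper // => /prodf_neq0 h i; exact: h.
Qed.

Lemma diagm_upper (a : 'I_n -> F) : torus a -> upper (diagm a) /\ diagm a \in unitmx.
Proof.
move=> ta; have ua : upper (diagm a) by move=> i j ij; rewrite mxE -val_eqE gtn_eqF.
split=> //; rewrite unitmxE unitfE det_upper //; apply/prodf_neq0 => i _.
by rewrite mxE eqxx; apply: ta.
Qed.

Lemma character_neq0 lam (a : 'I_n -> F) : torus a -> character lam a != 0.
Proof. by move=> ta; apply/prodf_neq0 => i _; rewrite expfz_neq0 ?ta. Qed.

(** An invertible upper triangular matrix is a diagonal one times a unitriangular one, so the two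
    conditions merge into one law for the Borel subgroup. *)
Lemma U_inv_weightP lam f : U_inv_weight lam f <->
  forall g A : 'M[F]_n, upper g -> g \in unitmx ->
    ev f A = character lam (fun i => g i i) * ev f (g *m A *m invmx g).
Proof.
split=> [[hU hT] g A ug uug|h].
  have ta := invmx_upper ug uug; have [_ ua] := diagm_upper ta.
  set a := diagm _ in ua; set B := g *m A *m invmx g.
  have aE (M : 'M[F]_n) i j : (a *m M) i j = g i i * M i j.
    rewrite mxE (bigD1 i) //= big1 ?addr0 => [|k ki]; first by rewrite mxE eqxx.
    by rewrite mxE eq_sym (negPf ki) mul0r.
  have [u gE] : exists u, g = a *m u by exists (invmx a *m g); rewrite mulKVmx.
  have uE i j : g i j = g i i * u i j by rewrite {1}gE aE.
  have uu : unitri u.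
    move=> i j; split=> [ij|<-]; apply: (mulfI (ta i)); rewrite -uE ?mulr1 //.
    by rewrite ug // mulr0.
  have e : A = invmx u *m (invmx a *m B *m a) *m u.
    have uuu : u \in unitmx by move: uug; rewrite gE unitmx_mul => /andP[].
    apply: (can_inj (mulKmx uuu)); rewrite /B !mulmxA mulmxV // mul1mx.
    by rewrite -[RHS]mulmxA -gE mulmxKV // [X in _ *m X *m _]gE mulKmx.
  by rewrite {1}e -ev_act (hU u uu) -ev_act (hT _ ta) evZ.
split=> [u uu|a ta]; apply: ev_inj => A; rewrite ev_act.
  have [up uu1] := unitri_upper uu.
  rewrite (h u (_ *m _) up uu1) [character _ _](_ : _ = 1) ?mul1r.
    by rewrite -!mulmxA mulmxV // mulmx1 mulKVmx.
  apply: big1 => i _; have [_ ->//] := uu i i; exact: exp1rz.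
have [up ua] := diagm_upper ta.
rewrite (h _ (_ *m _) up ua) evZ; congr (_ * _).
  by apply: eq_bigr => i _; rewrite mxE eqxx.
by rewrite -!mulmxA mulmxV // mulmx1 mulKVmx.
Qed.

End Ev.
End Evaluation.

(** * Semi-invariants on the big cell *)

Lemma invmx_mul (R : comUnitRingType) n (A B : 'M[R]_n) :
  A \in unitmx -> B \in unitmx -> invmx (A *m B) = invmx B *m invmx A.
Proof.
move=> uA uB; have uAB : A *m B \in unitmx by rewrite unitmx_mul uA.
apply: (can_inj (mulKmx uAB)); rewrite mulmxV // !mulmxA mulmxK // mulmxV //.
Qed.

(** The block matrix [P] is reduced to triangular form from the right and from the left, which
    computes its determinant in two ways. *)
Lemma det_add1_rank1 (R : comNzRingType) k (u : 'cV[R]_k) (v : 'rV[R]_k) :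
  \det (1%:M + u *m v) = 1 + (v *m u) ord0 ord0.
Proof.
pose P : 'M[R]_(1 + k) := block_mx 1%:M (- v) u 1%:M.
have e1 : P *m block_mx 1%:M v 0 1%:M = block_mx 1%:M 0 u (1%:M + u *m v).
  rewrite mulmx_block !mul1mx !mulmx1 !mulmx0 !addr0 subrr.
  by rewrite [u *m v + _]addrC.
have e2 : block_mx 1%:M v 0 1%:M *m P = block_mx (1%:M + v *m u) 0 u 1%:M.
  by rewrite mulmx_block !mul1mx !mulmx1 !mul0mx !add0r addNr.
have := congr1 determinant e1; rewrite det_mulmx det_ublock !det1 !mulr1 => d1.
have := congr1 determinant e2; rewrite det_mulmx det_ublock !det1 !mul1r => d2.
move: d1; rewrite d2 !det_lblock !det1 mul1r mulr1 => <-.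
by rewrite [RHS]/= det_mx11 mxE mxE eqxx.
Qed.

Lemma upper_block (R : pzRingType) a b (A : 'M[R]_a) (B : 'M_(a, b)) (D : 'M_b) :
  upper A -> upper D -> upper (block_mx A B 0 D).
Proof.
move=> uA uD i j; case: (split_ordP i) => i' ->; case: (split_ordP j) => j' -> ij.
- by rewrite block_mxEul uA.
- by move: ij; rewrite /= ltnNge (leq_trans (ltnW (ltn_ord i')) (leq_addr _ _)).
- by rewrite block_mxEdl mxE.
- by rewrite block_mxEdr uD // -(ltn_add2l a).
Qed.

Lemma upper1 (R : pzRingType) a : upper (1%:M : 'M[R]_a).
Proof. by move=> i j ij; rewrite mxE -val_eqE gtn_eqF. Qed.

Section Generation.
Variables (F : closedFieldType) (p t : nat).
Local Notation n := (p + t)%N.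

(** The parabolic with diagonal blocks of sizes 1, [p], [t], restricted to matrices fixing the first
    basis vector; [opp_unip] is a chart for the span of the last [t] rows. *)
Definition parab (h : 'rV[F]_n) (A : 'M_p) (B : 'M_(p, t)) (D : 'M_t) : 'M[F]_n.+1 :=
  block_mx (1%:M : 'M_1) h 0 (block_mx A B 0 D).
Definition opp_unip (Z : 'M[F]_(t, p)) : 'M[F]_n.+1 :=
  block_mx (1%:M : 'M_1) 0 0 (block_mx 1%:M 0 Z 1%:M).
Definition krylovD (x : 'M[F]_n.+1) : 'M[F]_t :=
  drsubmx (drsubmx (krylov x : 'M_(1 + (p + t)))).
Definition krylovY (x : 'M[F]_n.+1) : 'M[F]_(t, p) :=
  dlsubmx (drsubmx (krylov x : 'M_(1 + (p + t)))).

Lemma parab_mul h A B D h' A' B' D' :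
  parab h A B D *m parab h' A' B' D' =
  parab (h' + h *m block_mx A' B' 0 D') (A *m A') (A *m B' + B *m D') (D *m D').
Proof.
rewrite /parab (@mulmx_block F 1 n 1 n 1 n) !(mul1mx, mul0mx, mulmx0) !(addr0, add0r).
by rewrite mulmx_block !mul0mx !mulmx0 !(addr0, add0r).
Qed.

Lemma parab_opp_unip h A B D Z : parab h A B D *m opp_unip Z =
  block_mx (1%:M : 'M_1) (h *m block_mx 1%:M 0 Z 1%:M) 0
    (block_mx (A + B *m Z) B (D *m Z) D).
Proof.
rewrite /parab (@mulmx_block F 1 n 1 n 1 n) !(mul1mx, mul0mx, mulmx0) !(addr0, add0r).
by rewrite mulmx_block !(mul0mx, mulmx0, mulmx1) !(addr0, add0r).
Qed.

Lemma det_parab h A B D : \det (parab h A B D) = \det A * \det D.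
Proof. by rewrite /parab (@det_ublock _ 1) det1 mul1r det_ublock. Qed.

Lemma det_opp_unip Z : \det (opp_unip Z) = 1.
Proof. by rewrite /opp_unip (@det_ublock _ 1) det1 mul1r det_lblock !det1 mulr1. Qed.

Lemma parab_unit h A B D : (parab h A B D \in unitmx) = (A \in unitmx) && (D \in unitmx).
Proof. by rewrite !unitmxE det_parab unitrM. Qed.

Lemma opp_unip_unit Z : opp_unip Z \in unitmx.
Proof. by rewrite unitmxE det_opp_unip unitr1. Qed.

(** On upper triangular matrices with upper left entry 1, this is the inverse of the character
    [lambda_t t]. *)
Definition low_prod (g : 'M[F]_n.+1) : F :=
  \prod_(i < t) g (rshift 1 (rshift p i)) (rshift 1 (rshift p i)).

Lemma low_prod_parab h A B D : upper D -> low_prod (parab h A B D) = \det D.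
Proof.
move=> uD; rewrite det_upper //; apply: eq_bigr => i _.
by rewrite /parab (@block_mxEdr F 1 n 1 n) block_mxEdr.
Qed.

Section Function.
Variables (f0 : 'M[F]_n.+1 -> F) (r : nat).
Hypothesis pf0 : polyfun f0.
Hypothesis f0_semi : forall g A, upper g -> g \in unitmx -> g ord0 ord0 = 1 ->
  f0 (g *m A *m invmx g) = low_prod g ^+ r * f0 A.

(** Here [c] and [K] vary independently; the value is that of [f0] at [x] when [c = char_coefs x]
    and [K = krylov x] is invertible. *)
Definition companion_fun (c : 'rV[F]_n.+1) (K : 'M[F]_n.+1) : F := f0 (K *m compan c *m invmx K).

Lemma companion_fun_upper c g K : upper g -> g \in unitmx -> g ord0 ord0 = 1 -> K \in unitmx ->
  companion_fun c (g *m K) = low_prod g ^+ r * companion_fun c K.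
Proof.
by move=> *; rewrite /companion_fun invmx_mul // -f0_semi // !mulmxA.
Qed.

Lemma companion_fun_regular T J (X : J -> T -> F) (c : T -> 'rV_n.+1) (K : T -> 'M_n.+1) :
  gen_algmx X c -> gen_algmx X K ->
  exists q N, gen_alg X N /\
    forall s, K s \in unitmx -> companion_fun (c s) (K s) * \det (K s) ^+ q = N s.
Proof.
move=> hc hK.
have hC : gen_algmx X (fun s => compan (c s)).
  move=> i j; apply: (gen_alg_ext (f := fun s => (i == ord0)%:R * c s ord0 j
      - (i == j.+1 :> nat)%:R)); last by move=> s; rewrite mxE.
  by apply: gen_alg_sub; [apply: gen_alg_scale; apply: hc|apply: gen_alg_const].
have [q [N [hN eN]]] := gen_alg_scaled_inv pf0
  (gen_algmx_mul (gen_algmx_mul hK hC) (gen_algmx_adj hK)) (gen_alg_det hK).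
exists q, N; split=> // s uK; rewrite -eN; last by rewrite -unitfE -unitmxE.
by rewrite /companion_fun /invmx uK -scalemxAr.
Qed.

(** Along a family of constant nonzero determinant the denominator is a constant, so the function is
    polynomial in the parameters. *)
Lemma companion_fun_const_regular T J (X : J -> T -> F) (c : T -> 'rV_n.+1) (K : T -> 'M_n.+1)
    (P : T -> Prop) e : gen_algmx X c -> gen_algmx X K -> e != 0 ->
  (forall s, P s -> \det (K s) = e) ->
  exists N, gen_alg X N /\ forall s, P s -> companion_fun (c s) (K s) = N s.
Proof.
move=> hc hK e0 dK; have [q [N [hN eN]]] := companion_fun_regular hc hK.
exists (fun s => e ^- q * N s); split; first exact: gen_alg_scale.
move=> s Ps; rewrite -eN; last by rewrite unitmxE unitfE dK.
by rewrite dK // mulrC mulfK // expf_neq0.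
Qed.

(** [GL_semi_invariant] is applied to each diagonal block separately, with exponent 0 for [A] and
    [r] for [D], since [low_prod] sees only the last block. *)
Lemma companion_fun_parab c h A B D K : A \in unitmx -> D \in unitmx -> K \in unitmx ->
  companion_fun c (parab h A B D *m K) = \det D ^+ r * companion_fun c K.
Proof.
move=> uA uD uK.
have upp h' A' B' D' : upper A' -> upper D' -> upper (parab h' A' B' D').
  by move=> u1 u2; apply: (@upper_block _ 1 n); [apply: upper1|apply: upper_block].
have p00 h' A' B' D' : parab h' A' B' D' ord0 ord0 = 1.
  have -> : (ord0 : 'I_(1 + n)) = lshift n ord0 by apply/val_inj.
  by rewrite /parab (@block_mxEul F 1 n 1 n) mxE.
have algp1 M M' : gen_algmx (entry p p) (fun A' => parab 0 A' M M').
  apply: (@gen_algmx_block F _ _ _ 1 n 1 n); [exact: gen_algmx_const..|].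
  by apply: gen_algmx_block; [exact: gen_algmx_id|exact: gen_algmx_const..].
have algp2 M : gen_algmx (entry t t) (fun D' => parab 0 M 0 D').
  apply: (@gen_algmx_block F _ _ _ 1 n 1 n); [exact: gen_algmx_const..|].
  by apply: gen_algmx_block; [exact: gen_algmx_const..|exact: gen_algmx_id].
have stepA A' K' : A' \in unitmx -> K' \in unitmx ->
    companion_fun c (parab 0 A' 0 1%:M *m K') = companion_fun c K'.
  move=> uA' uK'.
  have [q [N [hN eN]]] := companion_fun_regular (gen_algmx_const _ c)
    (gen_algmx_mul (algp1 0 1%:M) (gen_algmx_const _ K')).
  have := @GL_semi_invariant F p (fun A => companion_fun c (parab 0 A 0 1%:M *m K'))
    (fun A => N A / \det K' ^+ q) q 0 _ _ _ A' uA'.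
  rewrite /= expr0 mul1r => -> //.
  - rewrite (_ : parab 0 1%:M 0 1%:M = 1%:M) ?mul1mx //.
    by rewrite /parab -!scalar_mx_block.
  - by apply: gen_alg_mul => //; apply: gen_alg_const.
  - move=> A1 uA1; rewrite -eN ?unitmx_mul ?parab_unit ?uA1 ?unitmx1 //.
    rewrite det_mulmx det_parab det1 mulr1 exprMn mulrA mulfK //.
    by rewrite expf_neq0 // -unitfE -unitmxE.
  - move=> g A1 ug uug uA1; rewrite expr0 mul1r.
    have -> : parab 0 (g *m A1) 0 1%:M = parab 0 g 0 1%:M *m parab 0 A1 0 1%:M.
      by rewrite parab_mul !mul0mx mulmx0 !addr0 mulmx1.
    rewrite -mulmxA companion_fun_upper ?unitmx_mul ?parab_unit ?uA1 ?uug ?unitmx1 //.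
    + by rewrite low_prod_parab ?det1 ?expr1n ?mul1r //; apply: upper1.
    + by apply: upp => //; apply: upper1.
have stepD D' K' : D' \in unitmx -> K' \in unitmx ->
    companion_fun c (parab 0 1%:M 0 D' *m K') = \det D' ^+ r * companion_fun c K'.
  move=> uD' uK'.
  have [q [N [hN eN]]] := companion_fun_regular (gen_algmx_const _ c)
    (gen_algmx_mul (algp2 1%:M) (gen_algmx_const _ K')).
  have := @GL_semi_invariant F t (fun D => companion_fun c (parab 0 1%:M 0 D *m K'))
    (fun A => N A / \det K' ^+ q) q r _ _ _ D' uD'.
  move=> -> //.
  - rewrite (_ : parab 0 1%:M 0 1%:M = 1%:M) ?mul1mx //.
    by rewrite /parab -!scalar_mx_block.
  - by apply: gen_alg_mul => //; apply: gen_alg_const.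
  - move=> A1 uA1; rewrite -eN ?unitmx_mul ?parab_unit ?uA1 ?unitmx1 //.
    rewrite det_mulmx det_parab det1 mul1r exprMn mulrA mulfK //.
    by rewrite expf_neq0 // -unitfE -unitmxE.
  - move=> g A1 ug uug uA1.
    have -> : parab 0 1%:M 0 (g *m A1) = parab 0 1%:M 0 g *m parab 0 1%:M 0 A1.
      by rewrite parab_mul !mul0mx mulmx0 !addr0 mulmx1.
    rewrite -mulmxA companion_fun_upper ?unitmx_mul ?parab_unit ?uA1 ?uug ?unitmx1 //.
    + by rewrite low_prod_parab.
    + by apply: upp => //; apply: upper1.
(* The remaining factor is unitriangular, so the original semi-invariance covers it. *)
have -> : parab h A B D = parab 0 A 0 1%:M *m (parab 0 1%:M 0 D *m
    parab h 1%:M (invmx A *m B) 1%:M).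
  rewrite !parab_mul !mul0mx !addr0 !mul1mx !mulmx1 mulmxA mulmxV // mul1mx.
  by [].
have uu : parab h 1%:M (invmx A *m B) 1%:M *m K \in unitmx.
  by rewrite unitmx_mul parab_unit !unitmx1.
rewrite -!mulmxA stepA ?stepD //; last by rewrite unitmx_mul parab_unit unitmx1 uD.
rewrite companion_fun_upper ?parab_unit ?unitmx1 //; last by apply: upp; apply: upper1.
by rewrite low_prod_parab ?det1 ?expr1n ?mul1r //; apply: upper1.
Qed.

(* [parab 0 A(s) (beta alpha) D(s) *m opp_unip (a b / s)] is polynomial in [s] of
   determinant -1, which shows that the pole at [s = 0] has order at most [r]. *)
Lemma companion_fun_rank1 c (a : 'cV[F]_t) (b : 'rV[F]_p) (al : 'rV[F]_t) (be : 'cV[F]_p) :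
  al *m a = 1%:M -> b *m be = 1%:M ->
  exists P : {poly F}, forall s, s != 0 ->
    s ^+ r * companion_fun c (opp_unip (s^-1 *: (a *m b))) = P.[s].
Proof.
move=> ha hb.
pose M s := block_mx (1%:M : 'M[F]_1) 0 0
  (block_mx (1%:M - be *m b) (be *m al) (a *m b) (1%:M + (s - 1) *: (a *m al))).
have hM : gen_algmx (coord1 (F:=F)) M.
  apply: (@gen_algmx_block F _ _ _ 1 n 1 n); [exact: gen_algmx_const..|].
  apply: gen_algmx_block; [exact: gen_algmx_const..|].
  apply: gen_algmx_add; first exact: gen_algmx_const.
  apply: gen_algmx_scale; last exact: gen_algmx_const.
  by apply: gen_alg_sub; [apply: (gen_alg_gen _ tt)|apply: gen_alg_const].
(* The coefficients give determinants [- s^-1] for [A s] and [s] for [D s]; the pole of [A s]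
   cancels in [A s + be *m al *m (s^-1 *: (a *m b))]. *)
pose A s := 1%:M - (1 + s^-1) *: (be *m b).
pose D s := 1%:M + (s - 1) *: (a *m al).
have dA s : \det (A s) = - s^-1.
  rewrite /A scalemxAl -mulNmx det_add1_rank1 mulmxN -scalemxAr hb !mxE eqxx.
  by rewrite mulr1 opprD addrA subrr add0r.
have dD s : \det (D s) = s.
  by rewrite /D scalemxAl det_add1_rank1 -scalemxAr ha !mxE eqxx mulr1 addrC subrK.
have eM s : s != 0 -> M s = parab 0 (A s) (be *m al) (D s) *m opp_unip (s^-1 *: (a *m b)).
  move=> s0; rewrite parab_opp_unip mul0mx /M; congr (block_mx _ _ _ (block_mx _ _ _ _)).
    rewrite /A -scalemxAr -mulmxA (mulmxA al) ha mul1mx -addrA; congr (_ + _).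
    by rewrite -scaleNr -scalerDl opprD subrK scaleN1r.
  rewrite /D -scalemxAr mulmxDl mul1mx -scalemxAl -mulmxA (mulmxA al) ha mul1mx.
  have -> : a *m b + (s - 1) *: (a *m b) = s *: (a *m b).
    by rewrite -{1}[a *m b]scale1r -scalerDl addrC subrK.
  by rewrite scalerA mulVf ?scale1r.
have dM s : s != 0 -> \det (M s) = -1.
  move=> s0; rewrite eM // det_mulmx det_parab det_opp_unip dA dD mulr1 mulNr.
  by rewrite mulVf.
have [|N [hN eN]] := companion_fun_const_regular (gen_algmx_const _ c) hM _ dM.
  by rewrite oppr_eq0 oner_neq0.
case/gen_alg_poly: hN => P hP; exists P => s s0; rewrite -hP -eN // eM //.
(* Only the determinant of [D s] enters the character, and it produces the factor [s ^+ r]. *)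
rewrite companion_fun_parab ?opp_unip_unit ?dD // unitmxE unitfE ?dA ?dD //.
by rewrite oppr_eq0 invr_eq0.
Qed.

Lemma krylov_unit_fun x : krylov x \in unitmx -> f0 x = companion_fun (char_coefs x) (krylov x).
Proof. by move=> uK; rewrite /companion_fun -krylovE mulmxK. Qed.

(** When [krylovD x] is invertible, [krylov x] factors as a parabolic matrix times [opp_unip Z], and
    the parabolic factor contributes only its character. *)
Lemma f0_big_cell x : krylov x \in unitmx -> krylovD x \in unitmx ->
  f0 x = \det (krylovD x) ^+ r *
    companion_fun (char_coefs x) (opp_unip (invmx (krylovD x) *m krylovY x)).
Proof.
move=> uK uD; rewrite krylov_unit_fun //.
set c := char_coefs x; set Z := invmx _ *m _.
pose K : 'M_(1 + n) := krylov x; pose h := ursubmx K.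
pose A0 := ulsubmx (drsubmx K); pose B0 := ursubmx (drsubmx K).
have EK : krylov x = parab (h *m block_mx 1%:M 0 (- Z) 1%:M) (A0 - B0 *m Z) B0 (krylovD x)
    *m opp_unip Z.
  rewrite parab_opp_unip -mulmxA mulmx_block !(mul1mx, mul0mx, mulmx1, mulmx0) !(addr0, add0r).
  rewrite addNr -scalar_mx_block mulmx1 subrK mulKVmx //.
  have e1 : ulsubmx K = 1%:M.
    apply/matrixP => i j; rewrite !ord1 [LHS]mxE [LHS]mxE [RHS]mxE.
    rewrite (_ : lshift n 0 = ord0); last exact/val_inj.
    exact: krylov_col0.
  have e2 : dlsubmx K = 0.
    apply/matrixP => i j; rewrite (ord1 j) [LHS]mxE [LHS]mxE [RHS]mxE.
    rewrite (_ : lshift n 0 = ord0); last exact/val_inj.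
    exact: krylov_col0.
  by rewrite -[LHS](@submxK _ 1 n 1 n) -/K e1 e2 -[drsubmx K]submxK.
rewrite EK companion_fun_parab ?opp_unip_unit //.
by move: uK; rewrite EK unitmx_mul parab_unit => /andP[/andP[]].
Qed.

End Function.

Lemma krylov_polyfun : gen_algmx (entry n.+1 n.+1) (@krylov F n).
Proof.
move=> i j; apply: (gen_alg_ext (ev_polyfun (dxi ord0 i (s_inv F n.+1 j.+1)))) => A.
by rewrite ev_dxi_s [RHS]mxE.
Qed.

(** [Zm] gives linear coordinates on the chart, with every nonzero point of rank one. The pole bound
    of [companion_fun_rank1] then limits the degree in these coordinates to [r], so multiplying by
    [w0 ^+ r] clears all denominators. *)
Lemma semi_invariant_generation N (Zm : 'rV[F]_N -> 'M[F]_(t, p)) (f0 : 'M[F]_n.+1 -> F) r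
    J (X : J -> 'M[F]_n.+1 -> F) w0 (w : 'I_N -> 'M[F]_n.+1 -> F) :
  gen_algmx (entry 1 N) Zm ->
  (forall s z, Zm (s *: z) = s *: Zm z) ->
  (forall z, z != 0 -> exists (a : 'cV[F]_t) (b : 'rV[F]_p) (al : 'rV[F]_t) (be : 'cV[F]_p),
     [/\ Zm z = a *m b, al *m a = 1%:M & b *m be = 1%:M]) ->
  polyfun f0 ->
  (forall g A, upper g -> g \in unitmx -> g ord0 ord0 = 1 ->
     f0 (g *m A *m invmx g) = low_prod g ^+ r * f0 A) ->
  (forall j, polyfun (X j)) ->
  (forall j, gen_alg X (fun x => char_coef x j)) -> gen_alg X w0 -> (forall j, gen_alg X (w j)) ->
  (forall x, krylovD x \in unitmx -> w0 x = \det (krylovD x) /\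
     invmx (krylovD x) *m krylovY x = Zm (\row_j (w j x / w0 x))) ->
  gen_alg X f0.
Proof.
move=> algZ ZmZ Zrank pf0 semi pfX algs algw0 algw hw.
pose T := ('rV[F]_n.+1 * 'rV[F]_N)%type.
pose X1 (j : 'I_n.+1) (cz : T) := cz.1 ord0 j; pose X2 (j : 'I_N) (cz : T) := cz.2 ord0 j.
pose X12 j := match j with inl j1 => X1 j1 | inr j2 => X2 j2 end.
have hc : gen_algmx X12 (fun cz : T => cz.1).
  by move=> i j; rewrite (ord1 i); apply: (gen_alg_gen X12 (inl j)).
have hz : gen_algmx X12 (fun cz : T => cz.2).
  by move=> i j; rewrite (ord1 i); apply: (gen_alg_gen X12 (inr j)).
have hS : gen_algmx X12 (fun cz : T => opp_unip (Zm cz.2)).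
  apply: (@gen_algmx_block F _ _ _ 1 n 1 n); [exact: gen_algmx_const..|].
  apply: gen_algmx_block; [exact: gen_algmx_const..| |exact: gen_algmx_const].
  by move=> i j; apply: (polyfun_comp (algZ i j) hz).
have [//|Q [algQ eQ]] := companion_fun_const_regular pf0 (P := fun=> True) (e := 1) hc hS
  (oner_neq0 _).
  by move=> cz _; apply: det_opp_unip.
have [q [algq qE qhom]] := gen_alg_homog algQ.
have qZ c z s : companion_fun f0 c (opp_unip (Zm (s *: z))) = (q (c, z)).[s].
  rewrite (eQ (c, s *: z)) // qE.
  have hs d : (q (c, s *: z))`_d = s ^+ d * (q (c, z))`_d.
    by apply: qhom => // j; rewrite /X2 mxE.
  rewrite (@horner_coef_wide _ (maxn (size (q (c, s *: z))) (size (q (c, z))))) ?leq_maxl //.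
  rewrite (@horner_coef_wide _ (maxn (size (q (c, s *: z))) (size (q (c, z))))) ?leq_maxr //.
  by apply: eq_bigr => i _; rewrite hs expr1n mulr1 mulrC.
have qsize c z : (size (q (c, z)) <= r.+1)%N.
  (* At the origin homogeneity with scale 0 kills all positive degrees. *)
  have [->|z0] := eqVneq z 0.
    apply/leq_sizeP => d hd; rewrite (qhom (c, 0) _ 0) // => [|j].
      by rewrite -(subnKC hd) addSn exprS !mul0r.
    by rewrite /X2 mxE mul0r.
  have [a [b [al [be [eZ ha hb]]]]] := Zrank z z0.
  have [P hP] := companion_fun_rank1 pf0 semi c ha hb.
  apply: (@laurent_size_le _ _ P) => s s0; rewrite -hP // -qZ.
  by rewrite ZmZ eZ.
pose wr x := \row_j w j x.
(* The polynomial in the ratios [w j x / w0 x], homogenized to degree [r] by [w0]. *)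
pose g x := \sum_(d < r.+1) w0 x ^+ (r - d) * (q (char_coefs x, wr x))`_d.
have algg : gen_alg X g.
  apply: gen_alg_sum => d _; apply: gen_alg_mul; first exact: gen_alg_exp.
  apply: (gen_alg_comp (phi := fun x => (char_coefs x, wr x)) _ (algq d)) => -[j|j].
    by apply: (gen_alg_ext (algs j.+1)) => x; rewrite /X1 mxE.
  by apply: (gen_alg_ext (algw j)) => x; rewrite /X2 mxE.
have pfg : polyfun g by apply: (gen_alg_comp (phi := id) _ algg).
have pfd : polyfun (fun x => \det (krylov x) * \det (krylovD x)).
  apply: gen_alg_mul; apply: gen_alg_det; first exact: krylov_polyfun.
  move=> i j; apply: (gen_alg_ext (krylov_polyfun (rshift 1 (rshift p i))
    (rshift 1 (rshift p j)))) => x.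
  by rewrite !mxE.
apply: (gen_alg_ext algg).
apply: (@polyfun_density _ _ _ _ _ _ (compan 0) pfd pfg pf0).
  rewrite krylov_compan0 det1 mul1r /krylovD krylov_compan0.
  suff -> : drsubmx (drsubmx (1%:M : 'M[F]_(1 + (p + t)))) = 1%:M by rewrite det1 oner_neq0.
  by apply/matrixP => i j; rewrite !mxE !(inj_eq (@rshift_inj _ _)).
move=> x; rewrite mulf_eq0 negb_or => /andP[dK dD].
have uK : krylov x \in unitmx by rewrite unitmxE unitfE.
have uD : krylovD x \in unitmx by rewrite unitmxE unitfE.
have [ew0 eZ] := hw x uD.
rewrite (f0_big_cell pf0 semi) // eZ -ew0.
have w00 : w0 x != 0 by rewrite ew0.
have -> : \row_j (w j x / w0 x) = (w0 x)^-1 *: wr x.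
  by apply/rowP => j; rewrite !mxE mulrC.
rewrite qZ (@horner_coef_wide _ r.+1) // mulr_sumr; apply: eq_bigr => d _.
have hd : (d <= r)%N by rewrite -ltnS.
rewrite mulrCA exprVn -expfB_cond ?(negPf w00) //.
by rewrite mulrC.
Qed.

End Generation.

(** * Generation and algebraic independence *)

Lemma rmorph_meval (R S : comNzRingType) (f : {rmorphism R -> S}) k (w : 'I_k -> R)
  (P : {mpoly R[k]}) : f P.@[w] = (map_mpoly f P).@[fun i => f (w i)].
Proof.
elim/mpoly_ring_ind: P => [c|i|p q hp hq|p q hp hq].
- by rewrite mevalC map_mpolyC mevalC.
- by rewrite mevalXU map_mpolyX mevalXU.
- by rewrite mevalD !rmorphD hp hq.
- by rewrite !rmorphM /= hp hq.
Qed.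

Section Packaging.
Variables (F : closedFieldType) (n M : nat) (w : 'I_M -> kg F n).

Definition invariant_coefs (P : {mpoly (kg F n)[M]}) := forall mo, G_invariant (P@_mo).

Lemma G_invariant_nat k : G_invariant (k%:R : kg F n).
Proof. by rewrite -mpolyC_nat; apply: G_invariant_C. Qed.

Lemma invariant_coefsC c : G_invariant c -> invariant_coefs c%:MP.
Proof. by move=> hc mo; rewrite mcoeffC; apply: G_invariant_M => //; apply: G_invariant_nat. Qed.

Lemma invariant_coefsX i : invariant_coefs 'X_i.
Proof. by move=> mo; rewrite mcoeffX; apply: G_invariant_nat. Qed.

Lemma invariant_coefsD P Q : invariant_coefs P -> invariant_coefs Q -> invariant_coefs (P + Q).
Proof. by move=> hP hQ mo; rewrite mcoeffD; apply: G_invariant_D. Qed.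

Lemma invariant_coefsM P Q : invariant_coefs P -> invariant_coefs Q -> invariant_coefs (P * Q).
Proof.
move=> hP hQ mo; rewrite mcoeffM; elim/big_rec: _ => [|k x _ hx].
  by have := G_invariant_nat 0; rewrite mulr0n.
by apply: G_invariant_D => //; apply: G_invariant_M.
Qed.

Definition inv_gens (j : nat + 'I_M) (x : 'M[F]_n) : F :=
  match j with inl j => char_coef x j | inr i => ev (w i) x end.

(** Membership in an algebra of functions is turned into a polynomial in the [w i] whose
    coefficients are invariants. *)
Lemma gen_alg_mpoly phi : gen_alg inv_gens phi ->
  exists P, invariant_coefs P /\ forall x, ev P.@[w] x = phi x.
Proof.
elim=> [[j|i]|c|f g _ [P [hP eP]] _ [Q [hQ eQ]]|f g _ [P [hP eP]] _ [Q [hQ eQ]]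
  |f g _ [P [hP eP]] e].
- exists (s_inv F n j)%:MP; split; first exact/invariant_coefsC/G_invariant_s.
  by move=> x; rewrite mevalC ev_s_inv.
- by exists 'X_i; split=> [|x]; [exact: invariant_coefsX|rewrite mevalXU].
- exists (c%:MP)%:MP; split; first exact/invariant_coefsC/G_invariant_C.
  by move=> x; rewrite mevalC evC.
- by exists (P + Q); split=> [|x]; [exact: invariant_coefsD|rewrite mevalD evD eP eQ].
- by exists (P * Q); split=> [|x]; [exact: invariant_coefsM|rewrite mevalM evM eP eQ].
- by exists P; split=> // x; rewrite eP.
Qed.

(** Along the conjugacy class of [x] the coefficients of [P] stay fixed while the [w i] take all
    values with [y i0 != 0]. Hence the specialized polynomial vanishes for every [x] with
    [d x != 0], and density finishes. *)
Lemma algebraic_independence (d : 'M[F]_n -> F) x1 i0 P :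
  polyfun d -> d x1 != 0 ->
  (forall x (y : 'I_M -> F), d x != 0 -> y i0 != 0 ->
     exists2 g, g \in unitmx & forall i, ev (w i) (g *m x *m invmx g) = y i) ->
  invariant_coefs P -> P.@[w] = 0 -> P = 0.
Proof.
move=> pfd dx1 surj hP P0.
pose v (x : 'M[F]_n) i := mxvec x ord0 i.
pose Pat x : {mpoly F[M]} := map_mpoly (meval (v x)) P.
have Pconj g x : g \in unitmx -> Pat (g *m x *m invmx g) = Pat x.
  move=> ug; apply/mpolyP => mo; rewrite !mcoeff_map_mpoly.
  by have /G_invariantP := hP mo; apply.
have Pat0 x : d x != 0 -> Pat x = 0.
  (* The factor ['X_i0] takes care of the points where [y i0 = 0]. *)
  move=> dx; suff : Pat x * 'X_i0 = 0.
    have X0 : 'X_i0 != 0 :> {mpoly F[M]}.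
      apply/eqP => /(congr1 (meval (fun=> 1)))/eqP.
      by rewrite mevalXU meval0 oner_eq0.
    by move/eqP; rewrite mulf_eq0 (negPf X0) orbF => /eqP.
  apply: mpoly_eq0_ext => y; rewrite mevalM mevalXU.
  have [->|y0] := eqVneq (y i0) 0; first by rewrite mulr0.
  have [g ug hg] := surj x y dx y0.
  rewrite -(meval_eq _ hg) -(Pconj g x ug) -[X in X * _]rmorph_meval P0.
  by rewrite rmorph0 mul0r.
apply/mpolyP => mo; rewrite mcoeff0; apply: ev_inj => x.
rewrite [RHS]raddf0; move: x.
apply: (polyfun_density pfd (ev_polyfun _) (gen_alg_const _ 0) dx1) => x dx.
have := congr1 (fun Q : {mpoly F[M]} => Q@_mo) (Pat0 x dx).
by rewrite /= mcoeff0 mcoeff_map_mpoly.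
Qed.

End Packaging.

Section Free.
Variables (F : closedFieldType) (p t : nat).
Local Notation n := (p + t)%N.

Definition low_block (g : 'M[F]_n.+1) : 'M[F]_t := drsubmx (drsubmx (g : 'M_(1 + (p + t)))).
Definition low_rows (x : 'M[F]_n.+1) : 'M[F]_(t, n) :=
  dsubmx (drsubmx (krylov x : 'M_(1 + (p + t)))).

Lemma low_rows_conj g x : upper g -> g \in unitmx ->
  low_rows (g *m x *m invmx g) = ((g ord0 ord0)^-1 *: low_block g) *m low_rows x.
Proof.
move=> hg ug; have g0 i : g i ord0 = g ord0 ord0 * (i == ord0)%:R.
  have [->|i0] := eqVneq i ord0; first by rewrite mulr1.
  by rewrite mulr0 hg // lt0n.
apply/matrixP => a b; rewrite -scalemxAl /low_rows (krylov_conj _ ug g0).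
rewrite [LHS]mxE [LHS]mxE [LHS]mxE [LHS]mxE [RHS]mxE; congr (_ * _).
rewrite [LHS]mxE [RHS]mxE.
have -> (h : 'I_n.+1 -> F) : \sum_i h i = \sum_(i < 1 + (p + t)) h i by [].
rewrite big_split_ord big_ord1 big_split_ord /= [X in X + _](_ : _ = 0) ?add0r; last first.
  by rewrite hg ?mul0r.
rewrite [X in X + _]big1 ?add0r => [|k _]; last first.
  by rewrite hg ?mul0r //= ltnS; apply: leq_trans (ltn_ord k) (leq_addr _ _).
by apply: eq_bigr => k _; rewrite !mxE.
Qed.

Lemma character_lambda r (a : 'I_n.+1 -> F) :
  character (fun i => (r%:Z * lambda_t t i)%R) a =
  a ord0 ^+ (r * t) * (\prod_(i < t) a (rshift 1 (rshift p i))) ^- r.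
Proof.
rewrite /character.
have -> (h : 'I_n.+1 -> F) : \prod_i h i = \prod_(i < 1 + (p + t)) h i by [].
rewrite big_split_ord big_ord1 big_split_ord /=; congr (_ * _).
  rewrite (_ : lshift n 0 = ord0); last exact/val_inj.
  by rewrite /lambda_t eqxx -PoszM.
rewrite big1 ?mul1r => [|i _].
  rewrite -exprVn -prodfV -prodrXl; apply: eq_bigr => i _.
  rewrite /lambda_t (_ : (_ <= _)%N); first by rewrite mulrN1 -invr_expz exprVn.
  by rewrite /= add1n -addSn addnK leq_addr.
rewrite /lambda_t (_ : (_ <= _)%N = false) ?mulr0 //.
by rewrite /= -addSn addnK add1n leqNgt ltnS ltn_ord.
Qed.

Lemma low_block_upper g : upper g -> upper (low_block g).
Proof.
move=> ug i j ij; rewrite !mxE ug //.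
by rewrite /= ltn_add2l ltn_add2l.
Qed.

Lemma low_prodE g : upper g -> low_prod g = \det (low_block g).
Proof.
by move=> ug; rewrite det_upper; [apply: eq_bigr => i _; rewrite !mxE|apply: low_block_upper].
Qed.

(** The [mu i] model the maximal minors of the last [t] rows and [eps] a common sign; [ka] and [sg]
    select the signed minors that are chart coordinates. *)
Variables (M N : nat) (mu : 'I_M -> 'M[F]_(t, n) -> F) (w : 'I_M -> kg F n.+1) (eps : F).
Variables (i0 : 'I_M) (Zm : 'rV[F]_N -> 'M[F]_(t, p)) (ka : 'I_N -> 'I_M) (sg : 'I_N -> F).
Hypothesis eps0 : eps != 0.
Hypothesis wE : forall i x, ev (w i) x = eps * mu i (low_rows x).
Hypothesis mu_mul : forall i D E, mu i (D *m E) = \det D * mu i E.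
Hypothesis mu_i0 : forall E, mu i0 E = \det (rsubmx E).
Hypothesis algZ : gen_algmx (entry 1 N) Zm.
Hypothesis ZmZ : forall s z, Zm (s *: z) = s *: Zm z.
Hypothesis Zrank : forall z, z != 0 ->
  exists (a : 'cV[F]_t) (b : 'rV[F]_p) (al : 'rV[F]_t) (be : 'cV[F]_p),
    [/\ Zm z = a *m b, al *m a = 1%:M & b *m be = 1%:M].
Hypothesis Zm_mu : forall Z, Z = Zm (\row_j (sg j * mu (ka j) (row_mx Z 1%:M))).
Hypothesis mu_surj : forall y, y i0 != 0 -> exists E, forall i, mu i E = y i.

Lemma w_weight i : U_inv_weight (@lambda_t n t) (w i).
Proof.
apply/U_inv_weightP => g x hg ug.
have -> : character (@lambda_t n t) (fun i => g i i)
    = character (fun i => (1%:Z * lambda_t t i)%R) (fun i => g i i).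
  by apply: eq_bigr => j _; rewrite mul1r.
rewrite character_lambda -/(low_prod g) low_prodE // !wE low_rows_conj // mu_mul detZ.
have g0 : g ord0 ord0 != 0 := invmx_upper hg ug ord0.
have d0 : \det (low_block g) != 0.
  by rewrite -low_prodE //; apply/prodf_neq0 => j _; apply: invmx_upper.
have : g ord0 ord0 ^+ t != 0 by rewrite expf_neq0.
rewrite mul1n expr1 exprVn; move: (_ ^+ t) => c c0.
by field; rewrite c0 d0.
Qed.

(** Prescribed last rows [E] are completed to an invertible [K] fixing the first basis vector.
    Conjugating by [K *m invmx (krylov x)] turns [krylov x] into [K]. *)
Lemma w_independent P : invariant_coefs P -> P.@[w] = 0 -> P = 0.
Proof.
apply: (@algebraic_independence F _ _ w (fun x => \det (krylov x)) (compan 0) i0).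
- exact/gen_alg_det/krylov_polyfun.
- by rewrite krylov_compan0 det1 oner_neq0.
move=> x y dK y0.
have uK : krylov x \in unitmx by rewrite unitmxE unitfE.
have y0' : eps^-1 * y i0 != 0 by rewrite mulf_neq0 // invr_eq0.
have [E hE] := @mu_surj (fun i => eps^-1 * y i) y0'.
pose K : 'M[F]_n.+1 := block_mx (1%:M : 'M_1) 0 0 (block_mx 1%:M 0 (lsubmx E) (rsubmx E)).
have uK' : K \in unitmx.
  rewrite unitmxE unitfE /K (@det_ublock F 1 n) det1 mul1r det_lblock det1 mul1r.
  by rewrite -mu_i0 hE.
have K0 i : K i ord0 = (i == ord0)%:R.
  have -> : (ord0 : 'I_n.+1) = lshift n (ord0 : 'I_1) by apply/val_inj.
  rewrite /K; case: (@split_ordP 1 n i) => k ->.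
    by rewrite (@block_mxEul F 1 n 1 n) (ord1 k) mxE !eqxx.
  by rewrite (@block_mxEdl F 1 n 1 n) mxE -val_eqE.
pose g := K *m invmx (krylov x).
have ug : g \in unitmx by rewrite unitmx_mul uK' unitmx_inv.
have g0 i : g i ord0 = 1 * (i == ord0)%:R.
  have : g *m col ord0 (krylov x) = col ord0 K.
    by rewrite !colE mulmxA mulmxKV.
  have -> : col ord0 (krylov x) = delta_mx ord0 ord0.
    by apply/matrixP => a b; rewrite [LHS]mxE krylov_col0 mxE (ord1 b) andbT.
  rewrite -colE => /matrixP/(_ i ord0); rewrite [LHS]mxE [RHS]mxE => ->.
  by rewrite K0 mul1r.
exists g => // i; rewrite wE.
have -> : low_rows (g *m x *m invmx g) = E.
  rewrite /low_rows (krylov_conj _ ug g0) invr1 scale1r mulmxKV //.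
  by rewrite (@block_mxKdr F 1 n 1 n) /block_mx col_mxKd hsubmxK.
by rewrite hE mulrA mulfV // mul1r.
Qed.

Lemma w_generates r f : U_inv_weight (fun i => (r%:Z * lambda_t t i)%R) f ->
  exists P, invariant_coefs P /\ f = P.@[w].
Proof.
move/U_inv_weightP => hf.
have algw i : gen_alg (inv_gens w) (fun x => mu i (low_rows x)).
  apply: (gen_alg_ext (gen_alg_scale eps^-1 (gen_alg_gen (inv_gens w) (inr i)))) => x.
  by rewrite /= wE mulrA mulVf // mul1r.
have : gen_alg (inv_gens w) (ev f).
  apply: (@semi_invariant_generation F p t N Zm (ev f) r _ (inv_gens w)
    (fun x => mu i0 (low_rows x)) (fun j x => sg j * mu (ka j) (low_rows x))) => //.
  - exact: ev_polyfun.
  - move=> g x hg ug g00.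
    have lp0 : low_prod g != 0 by apply/prodf_neq0 => j _; apply: invmx_upper.
    rewrite (hf g x) // character_lambda g00 expr1n mul1r mulrA mulfV ?mul1r //.
    by rewrite expf_neq0.
  - case=> [j|i] /=; last exact: ev_polyfun.
    by apply: (gen_alg_ext (ev_polyfun (s_inv F n.+1 j))) => x; rewrite ev_s_inv.
  - by move=> j; apply: (gen_alg_gen (inv_gens w) (inl j)).
  - by move=> j; apply: gen_alg_scale.
  - move=> x uD; rewrite mu_i0; split=> //.
    rewrite [LHS]Zm_mu; congr Zm; apply/rowP => j; rewrite !mxE -mulrA; congr (_ * _).
    have -> : row_mx (invmx (krylovD x) *m krylovY x) 1%:M = invmx (krylovD x) *m low_rows x.
      by rewrite -[low_rows x]hsubmxK mul_mx_row -/(krylovD x) mulVmx.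
    by rewrite mu_mul det_inv mulrC.
case/gen_alg_mpoly=> P [hP eP]; exists P; split=> //.
by apply: ev_inj => x; rewrite eP.
Qed.

Lemma free_generators_lambda : free_generators (@lambda_t n t) w.
Proof.
split; first exact: w_weight.
split; first by move=> P hP; apply: w_independent.
move=> R f hf.
suff h : forall s : seq 'I_R, exists P, invariant_coefs P /\ \sum_(r <- s) f r = P.@[w].
  exact: h.
elim=> [|r s [P [hP eP]]].
  exists 0; rewrite big_nil meval0; split=> // mo.
  by rewrite mcoeff0; have := @G_invariant_nat F n.+1 0; rewrite mulr0n.
have [Q [hQ eQ]] := w_generates (hf r).
exists (Q + P); rewrite big_cons mevalD eP eQ; split=> //; exact: invariant_coefsD.
Qed.

End Free.

(** * Minors and projective charts *)

Section IndexSets.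
Variables (m t : nat) (g : 'I_t -> 'I_m).
Hypothesis g_mono : forall a b : 'I_t, (a < b)%N -> (g a < g b)%N.

(** Column [k] of [low_rows] holds derivatives of the invariant with index [k + 2]: one shift comes
    from the dropped first column, one from counting invariants from 1. *)
Definition shifted_set : {set 'I_m.+2} := [set inord (2 + g b) | b : 'I_t].

Lemma inord_shift b : (inord (2 + g b) : 'I_m.+2) = (2 + g b)%N :> nat.
Proof. by rewrite inordK ?add2n ?ltnS. Qed.

Lemma mono_inj : injective g.
Proof.
move=> a b e; apply/val_inj/eqP; case: ltngtP => // /g_mono; by rewrite e ltnn.
Qed.

Lemma card_shifted_set : #|shifted_set| = t.
Proof.
rewrite card_imset ?card_ord // => a b /(congr1 val); rewrite /= !inord_shift.
by move/addnI/val_inj/mono_inj.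
Qed.

Lemma shifted_set_ge2 j : j \in shifted_set -> (2 <= j)%N.
Proof. by case/imsetP => b _ ->; rewrite inord_shift leq_addr. Qed.

Lemma shifted_set_admissible : admissible t shifted_set.
Proof.
rewrite /admissible card_shifted_set eqxx andbT; apply/forall_inP => j.
exact: shifted_set_ge2.
Qed.

(** Both lists are strictly increasing and have the same members. *)
Lemma Ielt_shifted_set (b : 'I_t) : Ielt shifted_set b = (2 + g b)%N.
Proof.
have e : map val (enum shifted_set) = [seq (2 + g b)%N | b <- enum 'I_t].
  apply: (irr_sorted_eq ltn_trans ltnn).
  - rewrite sorted_map /enum_mem; apply: sorted_filter.
      by move=> x y z; apply: ltn_trans.
    by rewrite -sorted_map -enumT val_enum_ord iota_ltn_sorted.
  - have h : sorted ltn (map val (enum 'I_t)) by rewrite val_enum_ord iota_ltn_sorted.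
    rewrite sorted_map; rewrite sorted_map in h; apply: (sub_sorted _ h) => a c ac.
    by rewrite /= ltn_add2l; apply: g_mono.
  move=> k; apply/mapP/mapP => [[x]|[c]]; rewrite mem_enum.
    by case/imsetP => c _ -> ->; exists c; rewrite ?mem_enum //; apply: inord_shift.
  move=> _ ->; exists (inord (2 + g c)); last exact/esym/inord_shift.
  by rewrite mem_enum; apply/imsetP; exists c.
rewrite /Ielt e (nth_map b); last by rewrite size_enum_ord.
by rewrite nth_ord_enum.
Qed.

Lemma admissible_shifted_set (I : {set 'I_m.+2}) :
  admissible t I -> (forall b, inord (2 + g b) \in I) -> I = shifted_set.
Proof.
case/andP => _ /eqP cI h; apply/esym/eqP; rewrite eqEcard cI card_shifted_set leqnn andbT.
by apply/subsetP => x /imsetP[b _ ->].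
Qed.

End IndexSets.

Section Minors.
Variables (F : closedFieldType) (p t : nat).
Local Notation n := (p + t)%N.

Lemma ev_u (g : 'I_t -> 'I_n) x : (forall a b : 'I_t, (a < b)%N -> (g a < g b)%N) ->
  ev (u_tI F t (shifted_set g)) x = \det (colsub g (low_rows x)).
Proof.
move=> gm; rewrite ev_det; congr (\det _); apply/matrixP => a b.
rewrite mxE [in X in ev X]mxE Ielt_shifted_set // add2n ev_dxi_s.
rewrite [RHS]mxE [RHS]mxE [RHS]mxE [RHS]mxE [RHS]mxE; congr (adj_coef _ _ _ _).
have e : (n.+1 - t + a = 1 + (p + a))%N by lia.
by apply/val_inj; rewrite /= e inordK // add1n ltnS ltn_add2l.
Qed.

(** Antitransposition lists the rows of the minor in reverse order, hence the sign of [rev_ord]. *)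
Lemma ev_v (g : 'I_t -> 'I_n) x : (forall a b : 'I_t, (a < b)%N -> (g a < g b)%N) ->
  ev (v_tI F t (shifted_set g)) (antitr x) =
  (-1) ^+ perm (@rev_ord_inj t) * \det (colsub g (low_rows x)).
Proof.
move=> gm; rewrite ev_det -det_perm -det_mulmx -row_permE; congr (\det _).
apply/matrixP => a b.
rewrite mxE [in X in ev X]mxE Ielt_shifted_set // add2n ev_dxi_s adj_coef_antitr [LHS]mxE.
rewrite [RHS]mxE [RHS]mxE [RHS]mxE [RHS]mxE [RHS]mxE [RHS]mxE permE; congr (adj_coef _ _ _ _).
- have ha : (a < n.+1)%N by apply: leq_trans (ltn_ord a) _; rewrite -addSn leq_addl.
  apply/val_inj; rewrite /= inordK //; have := ltn_ord a; lia.
- by apply/val_inj; rewrite /= subnn.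
Qed.

(** [None] stands for the minor on the last [t] columns, which is nonzero on the chart; [Some j]
    stands for the other minors. *)
Definition increasing_charts N (g : option 'I_N -> 'I_t -> 'I_n) :=
  [/\ g None =1 @rshift p t,
      forall o (a b : 'I_t), (a < b)%N -> (g o a < g o b)%N &
      forall I : {set 'I_n.+2}, admissible t I -> exists o, I = shifted_set (g o)].

Lemma free_generators_charts N (g : option 'I_N -> 'I_t -> 'I_n)
    (Zm : 'rV[F]_N -> 'M[F]_(t, p)) (sg : 'I_N -> F) (eps : F)
    (W : {set 'I_n.+2} -> kg F n.+1) :
  (0 < t)%N -> increasing_charts g -> eps != 0 ->
  (forall o x, ev (W (shifted_set (g o))) x = eps * \det (colsub (g o) (low_rows x))) ->
  gen_algmx (entry 1 N) Zm -> (forall s z, Zm (s *: z) = s *: Zm z) ->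
  (forall Z, exists z, Z = Zm z) ->
  (forall z, z != 0 -> exists (a : 'cV[F]_t) (b : 'rV[F]_p) (al : 'rV[F]_t) (be : 'cV[F]_p),
    [/\ Zm z = a *m b, al *m a = 1%:M & b *m be = 1%:M]) ->
  (forall j, sg j != 0) ->
  (forall z j, sg j * \det (colsub (g (Some j)) (row_mx (Zm z) 1%:M)) = z ord0 j) ->
  let Iset := [set I : {set 'I_n.+2} | admissible t I] in
  free_generators (@lambda_t n t) (fun i : 'I_#|Iset| => W (enum_val i)).
Proof.
move=> t0 [g0 gm gI] eps0 WE algZ ZmZ Zsurj Zrank sg0 hsg Iset.
have memI o : shifted_set (g o) \in Iset.
  by rewrite inE; apply: shifted_set_admissible; apply: gm.
pose idx o := enum_rank_in (memI None) (shifted_set (g o)).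
have idxK o : enum_val (idx o) = shifted_set (g o) by rewrite enum_rankK_in.
have idx_onto i : exists o, i = idx o.
  have : enum_val i \in Iset by apply: enum_valP.
  by rewrite inE => /gI[o e]; exists o; rewrite /idx -e enum_valK_in.
(* The columns are recovered by undoing the shift by 2; on admissible sets the index is in range and
   the default of [insubd] is not taken. *)
pose gi (i : 'I_#|Iset|) (b : 'I_t) : 'I_n :=
  insubd (rshift p b) (Ielt (enum_val i) b - 2)%N.
have giE o : gi (idx o) =1 g o.
  move=> b; rewrite /gi idxK Ielt_shifted_set; last exact: gm.
  by apply/val_inj; rewrite addKn val_insubd ltn_ord.
pose mu i E := \det (colsub (gi i) (E : 'M[F]_(t, n))).
have muE o E : mu (idx o) E = \det (colsub (g o) E).
  by congr (\det _); apply/matrixP => a b; rewrite !mxE giE.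
have mu_mul i D E : mu i (D *m E) = \det D * mu i E.
  rewrite -det_mulmx; congr (\det _); apply/matrixP => a b; rewrite !mxE.
  by apply: eq_bigr => k _; rewrite mxE.
have mu0 E : mu (idx None) E = \det (rsubmx E).
  by rewrite muE; congr (\det _); apply/matrixP => a b; rewrite !mxE g0.
apply: (@free_generators_lambda F p t _ N mu _ eps (idx None) Zm (fun j => idx (Some j)) sg).
- by [].
- by move=> i x; have [o ->] := idx_onto i; rewrite muE idxK WE.
- exact: mu_mul.
- exact: mu0.
- exact: algZ.
- exact: ZmZ.
- exact: Zrank.
- move=> Z; have [z ->] := Zsurj Z; congr Zm; apply/rowP => j.
  by rewrite mxE muE hsg.
- move=> y y0.
  (* The ratios of the prescribed values fix the chart point; rescaling one row by [D] then fixes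
     the minor on the last columns. *)
  pose z := \row_j (sg j * y (idx (Some j)) / y (idx None)).
  pose D : 'M[F]_t := diag_mx (\row_j if j == Ordinal t0 then y (idx None) else 1).
  have dD : \det D = y (idx None).
    rewrite det_diag (bigD1 (Ordinal t0)) //= mxE eqxx big1 ?mulr1 // => j j0.
    by rewrite mxE (negPf j0).
  exists (D *m row_mx (Zm z) 1%:M) => i; rewrite mu_mul dD.
  have [[j|] ->] := idx_onto i; last by rewrite mu0 row_mxKr det1 mulr1.
  apply: (mulfI (sg0 j)); rewrite mulrCA muE hsg mxE.
  by rewrite mulrC divfK.
Qed.

End Minors.

Section Rank1.
Variables (F : fieldType) (N : nat).

Lemma row_left_inverse (z : 'rV[F]_N) : z != 0 -> exists be : 'cV[F]_N, z *m be = 1%:M.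
Proof.
case/rV0Pn => j zj; exists ((z ord0 j)^-1 *: delta_mx j ord0).
apply/matrixP => a b; rewrite !ord1 -scalemxAr -colE !mxE mulVf //.
Qed.

End Rank1.

Section Cases.
Variable F : closedFieldType.
Variables (p t : nat).
Local Notation n := (p + t)%N.

(* [Zm], [sg] and [g] record the chart of the Grassmannian of t-planes
   in which the minor on the last t columns does not vanish; in the cases considered
   this Grassmannian is a projective space. *)
Definition projective_chart := exists N (g : option 'I_N -> 'I_t -> 'I_n)
    (Zm : 'rV[F]_N -> 'M[F]_(t, p)) (sg : 'I_N -> F),
  [/\ increasing_charts g,
      gen_algmx (entry 1 N) Zm /\ (forall s z, Zm (s *: z) = s *: Zm z),
      (forall Z, exists z, Z = Zm z) /\
      (forall z, z != 0 ->
        exists (a : 'cV[F]_t) (b : 'rV[F]_p) (al : 'rV[F]_t) (be : 'cV[F]_p),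
        [/\ Zm z = a *m b, al *m a = 1%:M & b *m be = 1%:M]),
      (forall j, sg j != 0) &
      forall z j, sg j * \det (colsub (g (Some j)) (row_mx (Zm z) 1%:M)) = z ord0 j].

End Cases.

(** * Charts in the three cases *)

Lemma admissible_ge2 m t (I : {set 'I_m.+2}) j : admissible t I -> j \in I -> (2 <= j)%N.
Proof. by case/andP => /forall_inP h _ /h. Qed.

(** The Grassmannian is a point: the only admissible set consists of all indices from 2 on. *)
Lemma projective_chart_p0 (F : closedFieldType) t : projective_chart F 0 t.
Proof.
exists 0%N, (fun _ => @rshift 0 t), (fun _ => 0), (fun _ => 1); split.
- split=> // I aI.
  exists None; apply: admissible_shifted_set => // b.
  have /eqP cI : #|I| == t by case/andP: aI.
  have : I \subset [set~ inord 0] :\ inord 1.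
    apply/subsetP => j jI; rewrite !inE -!val_eqE /= !inordK //.
    by have := admissible_ge2 aI jI; case: (nat_of_ord j) => [|[]].
  move=> sI; suff -> : I = [set~ inord 0] :\ inord 1.
    rewrite !inE -!val_eqE /= inordK; first by rewrite !inordK.
    by rewrite add2n !ltnS ltn_ord.
  apply/eqP; rewrite eqEcard sI cI /=.
  have := cardsD1 (inord 1) [set~ inord 0 : 'I_(0 + t).+2].
  rewrite cardsC1 card_ord !inE -val_eqE /= !inordK //= add0n add1n.
  by case=> <-.
- by split=> [|s z]; [apply: gen_algmx_const|rewrite scaler0].
- split=> [Z|z]; first by exists 0; apply: thinmx0.
  by rewrite (thinmx0 z) eqxx.
- by move=> j; rewrite oner_neq0.
- by move=> z [].
Qed.

(** For [t = 1] the maximal minors are the entries of the row, and [Z] itself is the coordinate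
    vector. *)
Lemma projective_chart_t1 (F : closedFieldType) p : projective_chart F p 1.
Proof.
exists p, (fun o b => if o is Some j then lshift 1 j else rshift p b), id, (fun _ => 1); split.
- split=> // [o a b|I aI]; first by rewrite !ord1 ltnn.
  have /cards1P[x eI] : #|I| == 1%N by case/andP: aI.
  have x2 : (2 <= x)%N by apply: (admissible_ge2 aI); rewrite eI inE.
  have hx : (x - 2 < p + 1)%N by have := ltn_ord x; lia.
  case: (split_ordP (Ordinal hx)) => k ek; [exists (Some k)|exists None];
    apply: admissible_shifted_set => //; try (by move=> a b; rewrite !ord1 ltnn).
    move=> b; rewrite eI inE; apply/eqP/val_inj.
    by rewrite -ek /= inordK subnKC.
  move=> b; rewrite eI inE; apply/eqP/val_inj.
  by rewrite (ord1 b) -(ord1 k) -ek /= inordK subnKC.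
- by split=> //; apply: gen_algmx_id.
- split=> [Z|z z0]; first by exists Z.
  have [be hb] := row_left_inverse z0.
  by exists 1%:M, z, 1%:M, be; rewrite !mul1mx.
- by move=> j; rewrite oner_neq0.
- by move=> z j; rewrite mul1r det_mx11 mxE row_mxEl.
Qed.

(** Bordering by the unit row [e] gives a matrix [M] with determinant [- Z j ord0]; expanding along
    that row leaves the wanted minor up to sign. *)
Lemma det_col'_row_mx1 (R : comNzRingType) t (Z : 'cV[R]_t) j :
  \det (col' (rshift 1 j : 'I_(1 + t)) (row_mx Z 1%:M)) = (-1) ^+ j * Z j ord0.
Proof.
pose e : 'rV[R]_t := delta_mx ord0 j.
pose M : 'M[R]_(1 + t) := block_mx 0 e Z 1%:M.
have dM : \det M = - Z j ord0.
  have : M *m block_mx 1%:M 0 (- Z) 1%:M = block_mx (- (e *m Z)) e 0 1%:M.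
    by rewrite mulmx_block !mul1mx !mulmx1 !mulmx0 !add0r mulmxN subrr.
  move/(congr1 determinant); rewrite det_mulmx det_lblock det_ublock !det1 !mulr1 => ->.
  by rewrite det_mx11 mxE -rowE mxE.
pose i0 : 'I_(1 + t) := lshift t ord0.
have := expand_det_row M i0; rewrite dM (bigD1 (rshift 1 j)) //= big1 ?addr0; last first.
  move=> k kj; case: (split_ordP k) kj => k' -> kj.
    by rewrite block_mxEul mxE mul0r.
  rewrite block_mxEur mxE eqxx /=; rewrite (inj_eq (@rshift_inj _ _)) in kj.
  by rewrite (negPf kj) mul0r.
rewrite {1}/M block_mxEur mxE !eqxx mul1r /cofactor.
have -> : row' i0 (col' (rshift 1 j) M) = col' (rshift 1 j : 'I_(1 + t)) (row_mx Z 1%:M).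
  apply/matrixP => a b; rewrite [LHS]mxE [LHS]mxE [RHS]mxE.
  rewrite (_ : lift i0 a = rshift 1 a); last exact/val_inj.
  by rewrite /M -[block_mx _ _ _ _]/(col_mx _ _) col_mxEd.
move=> e1; apply/esym; rewrite -[Z j ord0]opprK e1 /= add0n add1n exprS.
by rewrite mulN1r mulNr opprK signrMK.
Qed.

(** An admissible set omits exactly one index from 2 on, so the minors correspond to the omitted
    columns; [None] omits the first of them. *)
Lemma projective_chart_p1 (F : closedFieldType) t : projective_chart F 1 t.
Proof.
exists t, (fun o => lift (if o is Some j then rshift 1 j else (ord0 : 'I_(1 + t)))),
  (fun z => z^T), (fun j => (-1) ^+ j); split.
- have lm (l : 'I_(1 + t)) (a b : 'I_t) : (a < b)%N -> (lift l a < lift l b)%N.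
    have bump_mono h x y : (x < y)%N -> (bump h x < bump h y)%N by rewrite /bump; lia.
    exact: bump_mono.
  split=> [b|o|I aI]; [exact/val_inj|exact: lm|].
  have /eqP cI : #|I| == t by case/andP: aI.
  pose T2 := [set~ inord 0] :\ inord 1 : {set 'I_(1 + t).+2}.
  have sI : I \subset T2.
    apply/subsetP => j jI; rewrite !inE -!val_eqE /= !inordK //.
    by have := admissible_ge2 aI jI; case: (nat_of_ord j) => [|[]].
  have cT : #|T2| = t.+1.
    have := cardsD1 (inord 1) [set~ inord 0 : 'I_(1 + t).+2].
    rewrite cardsC1 card_ord !inE -val_eqE /= !inordK //= => e.
    exact/succn_inj/esym/e.
  have /cards1P[x ex] : #|T2 :\: I| == 1%N.
    by rewrite cardsD (setIidPr sI) cT cI subSnn.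
  have : x \in T2 :\: I by rewrite ex inE.
  rewrite !inE -!val_eqE /= !inordK // => /and3P[xI x1 x0].
  have x2 : (2 <= x)%N by case: (nat_of_ord x) x0 x1 => [|[]].
  have hx : (x - 2 < 1 + t)%N by have := ltn_ord x; lia.
  (* The image of [lift l] avoids [l], the position of the one omitted index [x]. *)
  have inI (l : 'I_(1 + t)) b : l = (x - 2)%N :> nat -> inord (2 + lift l b) \in I.
    move=> el; apply/negPn/negP => nI.
    have hb : (2 + lift l b < (1 + t).+2)%N by rewrite add2n 2!ltnS ltn_ord.
    have : inord (2 + lift l b) \in T2 :\: I by rewrite inE nI /T2 !inE -!val_eqE /= !inordK.
    rewrite ex inE -val_eqE /= inordK // => /eqP e.
    have eb : bump l b = l by rewrite [RHS]el -e addKn.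
    by have := neq_bump l b; rewrite eb eqxx.
  case: (split_ordP (Ordinal hx)) => k ek; [exists None|exists (Some k)];
    apply: admissible_shifted_set => //; try (exact: lm); move=> b; apply: inI.
    by move/(congr1 val): ek; rewrite /= (ord1 k).
  by move/(congr1 val): ek.
- split=> [i j|s z]; last by rewrite linearZ.
  by apply: (gen_alg_ext (gen_alg_gen _ (j, i))) => z; rewrite mxE.
- split=> [Z|z z0]; first by exists Z^T; rewrite trmxK.
  have [be hb] := row_left_inverse z0.
  exists z^T, 1%:M, be^T, 1%:M; rewrite !mulmx1; split=> //.
  by rewrite -trmx_mul hb trmx1.
- by move=> j; rewrite signr_eq0.
- move=> z j; rewrite -[colsub _ _]/(col' (rshift 1 j : 'I_(1 + t)) _).
  by rewrite det_col'_row_mx1 mxE signrMK.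
Qed.

(** * Transposition along the antidiagonal *)

Section AntiTranspose.
Variables (F : closedFieldType) (n : nat).

Definition antitr_poly : kg F n -> kg F n :=
  comp_mpoly [tuple (mxvec (antitr (Defs.genmx F n))) ord0 i | i < n * n].

Lemma ev_antitr f A : ev (antitr_poly f) A = ev f (antitr A).
Proof.
rewrite /ev /antitr_poly comp_mpoly_meval; apply: meval_eq => i; rewrite tnth_mktuple.
case/mxvec_indexP: i => i j; rewrite !mxvecE [in LHS]mxE [in LHS]mxE [RHS]mxE.
exact: ev_xi.
Qed.

Lemma antitr_polyK : involutive antitr_poly.
Proof. by move=> f; apply: ev_inj => A; rewrite !ev_antitr antitrK. Qed.

Lemma antitr_unit (g : 'M[F]_n) : (antitr g \in unitmx) = (g \in unitmx).
Proof. by rewrite !unitmxE det_antitr. Qed.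

Lemma antitr_inv (g : 'M[F]_n) : g \in unitmx -> antitr (invmx g) = invmx (antitr g).
Proof.
move=> ug; have ur : antitr g \in unitmx by rewrite antitr_unit.
by apply: (can_inj (mulKmx ur)); rewrite -antitr_mul mulVmx // mulmxV // antitr1.
Qed.

Lemma antitr_upper (g : 'M[F]_n) : upper g -> upper (antitr g).
Proof.
move=> ug i j ij; rewrite mxE ug //=; have := ltn_ord i; lia.
Qed.

Lemma antitr_G_invariant f : G_invariant f -> G_invariant (antitr_poly f).
Proof.
move/G_invariantP => hf; apply/G_invariantP => g A ug.
have ur : invmx (antitr g) \in unitmx by rewrite unitmx_inv antitr_unit.
by rewrite !ev_antitr !antitr_mul antitr_inv // -(hf _ (antitr A) ur) invmxK mulmxA.
Qed.

(** Reversing products replaces conjugation by [g] with conjugation by the inverse of [antitr g], so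
    weights are reversed and negated. *)
Lemma antitr_U_inv_weight (lam lam' : 'I_n -> int) f :
  (forall i, lam' i = - lam (rev_ord i)) -> U_inv_weight lam f -> U_inv_weight lam' (antitr_poly f).
Proof.
move=> hl /U_inv_weightP hf; apply/U_inv_weightP => g A ug uug.
have ur : antitr g \in unitmx by rewrite antitr_unit.
have th := invmx_upper (antitr_upper ug) ur.
rewrite !ev_antitr !antitr_mul antitr_inv // (hf (antitr g) (_ *m _) (antitr_upper ug) ur).
have -> : antitr g *m (invmx (antitr g) *m (antitr A *m antitr g)) *m invmx (antitr g) = antitr A.
  by rewrite mulKVmx // mulmxK.
rewrite mulrA (_ : character lam' _ * _ = 1) ?mul1r //.
rewrite -[RHS](mulVf (character_neq0 lam th)); congr (_ * _).
rewrite /character -prodfV [RHS](reindex_inj rev_ord_inj); apply: eq_bigr => i _.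
by rewrite mxE !rev_ordK hl -invr_expz.
Qed.

(** [antitr_poly] is an involutive ring automorphism preserving the invariants, so relations and
    expressions are transported by applying it to coefficients. *)
Lemma free_generators_antitr (lam lam' : 'I_n -> int) M (w : 'I_M -> kg F n) :
  (forall i, lam' i = - lam (rev_ord i)) ->
  free_generators lam (fun i => antitr_poly (w i)) -> free_generators lam' w.
Proof.
move=> hl [hw [hind hgen]].
have hl' i : lam i = - lam' (rev_ord i) by rewrite hl rev_ordK opprK.
pose T (P : {mpoly (kg F n)[M]}) := map_mpoly antitr_poly P.
have cT P mo : (T P)@_mo = antitr_poly P@_mo by apply: mcoeff_map_mpoly.
have hT P : invariant_coefs P -> invariant_coefs (T P).
  by move=> hP mo; rewrite cT; apply: antitr_G_invariant.
have eT P v : antitr_poly P.@[v] = (T P).@[fun i => antitr_poly (v i)] by apply: rmorph_meval.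
split; [|split].
- by move=> i; rewrite -[w i]antitr_polyK; apply: antitr_U_inv_weight (hw i).
- move=> P hP P0; have : T P = 0.
    by apply: hind; [exact: hT|rewrite -eT P0; exact: rmorph0].
  move=> h; apply/mpolyP => mo; apply: (inv_inj antitr_polyK).
  by rewrite -cT h !mcoeff0; apply/esym/rmorph0.
- move=> R f hf.
  have [|P [hP eP]] := hgen R (fun r => antitr_poly (f r)).
    move=> r; apply: antitr_U_inv_weight (hf r) => i.
    by rewrite hl' mulrN.
  exists (T P); split; first exact: hT.
  have tau_sum : antitr_poly (\sum_(r < R) f r) = \sum_(r < R) antitr_poly (f r).
    exact: rmorph_sum.
  apply: (inv_inj antitr_polyK); rewrite tau_sum eP eT.
  suff -> : T (T P) = P by [].
  by apply/mpolyP => mo; rewrite !cT antitr_polyK.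
Qed.

End AntiTranspose.

Lemma mu_t_rev n t i : mu_t t i = - @lambda_t n t (rev_ord i).
Proof.
rewrite /mu_t /lambda_t -!val_eqE /=; have hi := ltn_ord i.
have -> : (n.+1 - i.+1 == 0)%N = (i == n :> nat) by lia.
case: eqP => // ei; have -> : (n.+1 - t <= n.+1 - i.+1)%N = (i < t)%N by lia.
by case: ifP; rewrite ?opprK ?oppr0.
Qed.

Lemma free_generators_uv (F : closedFieldType) p t :
  (0 < t)%N -> projective_chart F p t ->
  let Iset := [set I : {set 'I_(p + t).+2} | admissible t I] in
  free_generators (@lambda_t (p + t) t) (fun i : 'I_#|Iset| => u_tI F t (enum_val i)) /\
  free_generators (@mu_t (p + t) t) (fun i : 'I_#|Iset| => v_tI F t (enum_val i)).
Proof.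
move=> t0 [N [g [Zm [sg [hg [algZ ZmZ] [Zsurj Zrank] sg0 hsg]]]]] Iset.
have gm o := (let: And3 _ gm _ := hg in gm o).
split.
  apply: (@free_generators_charts F p t N g Zm sg 1 (fun I => u_tI F t I)) => //.
    exact: oner_neq0.
  by move=> o x; rewrite mul1r ev_u //; apply: gm.
apply: (free_generators_antitr (@mu_t_rev _ t)).
apply: (@free_generators_charts F p t N g Zm sg ((-1) ^+ perm (@rev_ord_inj t))
  (fun I => antitr_poly (v_tI F t I))) => //; first by rewrite signr_eq0.
by move=> o x; rewrite ev_antitr ev_v //; apply: gm.
Qed.

(* The dimension is n := m.+1 (so the hypothesis n >= 2 reads 2 <= m.+1). *)
Theorem theorem2p4 (F : closedFieldType) (m t : nat)
  (hn : (2 <= m.+1)%N)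
  (ht : (t == 1%N) || ((3 <= m.+1)%N && (t \in [:: 1%N; (m.+1 - 2)%N; (m.+1 - 1)%N]))) :
  let Iset := [set I : {set 'I_m.+2} | admissible t I] in
  free_generators (@lambda_t m t)
    (fun i : 'I_#|Iset| => u_tI F t (enum_val i)) /\
  free_generators (@mu_t m t)
    (fun i : 'I_#|Iset| => v_tI F t (enum_val i)).
Proof.
(* With [p = m - t], the values [t = n - 2] and [t = n - 1] of the statement are [p = 1] and
   [p = 0]. *)
have [p [em t0 hc]] : exists p, [/\ m = (p + t)%N, (0 < t)%N & projective_chart F p t].
  move: ht; rewrite !inE => /orP[/eqP ->|/andP[m3 /or3P[]/eqP ->]].
  - exists m.-1; split=> //; [lia|exact: projective_chart_t1].
  - exists m.-1; split=> //; [lia|exact: projective_chart_t1].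
  - exists 1%N; split; [lia|lia|exact: projective_chart_p1].
  - exists 0%N; split; [lia|lia|exact: projective_chart_p0].
by subst m; apply: free_generators_uv.
Qed.
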